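(* Let $k$ be an algebraically closed field of characteristic zero. Let $\varphi_{\sqrt2,i}$ and $\varphi_{0,i}$ ($1\le i\le 6$) be the faithful representations of $PSL_2(\mathbf{F}_7)$ in $PGL_4(k)$ defined in the context, with $\varphi_{\sqrt2}=\varphi_{\sqrt2,1}$, $\varphi_0=\varphi_{0,1}$, and let $I_1=\{1,2,4\}$, $I_2=\{3,5,6\}$. Let $\kappa$ be the automorphism of $PGL_4(k)$ sending $(A)$ to $({A'}^{-1})$, where $A'$ is the transpose of $A\in GL_4(k)$. (1) The representations $\varphi_{\sqrt2,i}$ $(i\in I_1)$ are equivalent. The representations $\varphi_{\sqrt2,i}$ $(i\in I_2)$ are equivalent. The representations $\varphi_{\sqrt2,1}$ and $\varphi_{\sqrt2,6}$ are not equivalent, but $\varphi_{\sqrt2,6}=\kappa\circ\varphi_{\sqrt2,1}$ and $\mathrm{Im}\,\varphi_{\sqrt2,1}=\mathrm{Im}\,\varphi_{\sqrt2,6}$. (2) The representations $\varphi_{0,i}$ $(i\in I_1)$ are equivalent. The representations $\varphi_{0,i}$ $(i\in I_2)$ are equivalent. The representations $\varphi_{0,1}$ and $\varphi_{0,6}$ are not equivalent, but $\varphi_{0,6}=\kappa\circ\varphi_{0,1}$ and $\mathrm{Im}\,\varphi_{0,1}=\mathrm{Im}\,\varphi_{0,6}$. (3) Any faithful representation of $PSL_2(\mathbf{F}_7)$ in $PGL_4(k)$ is equivalent to one of $\varphi_{\sqrt2,1}$, $\varphi_{\sqrt2,6}$, $\varphi_{0,1}$ and $\varphi_{0,6}$.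 (4) A subgroup of $PGL_4(k)$ isomorphic to $PSL_2(\mathbf{F}_7)$ is conjugate to $\mathrm{Im}\,\varphi_{\sqrt2}$ or $\mathrm{Im}\,\varphi_0$.
   Context: A faithful representation of a group $G$ in $PGL_n(k)$ is an injective group homomorphism $G\to PGL_n(k)$; two such, $\varphi,\varphi'$, are equivalent if $\varphi'=\sigma\circ\varphi$ for some inner automorphism $\sigma$ of $PGL_n(k)$. $(A)$ denotes the class of $A\in GL_n(k)$ in $PGL_n(k)$. $PSL_2(\mathbf{F}_7)$ is generated by the classes $(a),(b),(c)$ of $a=\begin{bmatrix}1&1\\0&1\end{bmatrix}$, $b=\begin{bmatrix}5&0\\0&3\end{bmatrix}$, $c=\begin{bmatrix}0&-1\\1&0\end{bmatrix}$. Let $\varepsilon\in k^*$ have order $7$, and fix a square root $\sqrt2\in k$ of $2$. Put $A=\mathrm{diag}[\varepsilon^4,\varepsilon^2,\varepsilon,1]$, $B=[e_3,e_1,e_2,e_4]$ (columns of the unit matrix), and $$Z(\tau,\alpha,\beta,\gamma)=\begin{bmatrix}\alpha&\beta&\gamma&\tau\\\beta&\gamma&\alpha&\tau\\\gamma&\alpha&\beta&\tau\\\tau&\tau&\tau&1\end{bmatrix}.$$ Let $C_{\sqrt2}=Z(\sqrt2,\ \varepsilon+\varepsilon^6,\ \varepsilon^2+\varepsilon^5,\ \varepsilon^3+\varepsilon^4)$ and $C_0=Z(0,\alpha_0,\beta_0,\gamma_0)$ with $\alpha_0=\frac17(-2-\varepsilon+2\varepsilon^2+2\varepsilon^5-\varepsilon^6)$,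 $\beta_0=\frac17(-2-\varepsilon^2+2\varepsilon^3+2\varepsilon^4-\varepsilon^5)$, $\gamma_0=\frac17(-2+2\varepsilon-\varepsilon^3-\varepsilon^4+2\varepsilon^6)$. $\varphi_{\sqrt2}$ is the faithful representation of $PSL_2(\mathbf{F}_7)$ in $PGL_4(k)$ with $(a)\mapsto(A)$, $(b)\mapsto(B)$, $(c)\mapsto(C_{\sqrt2})$, and $\varphi_0$ is the faithful representation with $(a)\mapsto(A)$, $(b)\mapsto(B)$, $(c)\mapsto(C_0)$. For $1\le i\le 6$, $\varphi_{\sqrt2,i}$ and $\varphi_{0,i}$ are the representations obtained from $\varphi_{\sqrt2}$ and $\varphi_0$ by replacing $\varepsilon$ by $\varepsilon^i$ throughout ($\sqrt2$ being kept fixed). *)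

(* Defs.v *)
From HB Require Import structures.
From mathcomp Require Import all_boot all_order all_fingroup all_algebra.
From mathcomp Require Import all_solvable.
From mathcomp Require Import ring.
From mathcomp Require Import boolp classical_sets.

Set Implicit Arguments.
Unset Strict Implicit.
Unset Printing Implicit Defensive.

Import GRing.Theory.

Local Open Scope ring_scope.
Local Open Scope quotient_scope.

(** The library's [{'GL_n[R]}] requires a finite ring, hence a separate type. *)

Section GeneralLinear.
Variables (n : nat) (k : fieldType).

Record GL := MkGL { GLmx :> 'M[k]_n; _ : GLmx \in unitmx }.

HB.instance Definition _ := [isSub for GLmx].
HB.instance Definition _ := [Choice of GL by <:].

Implicit Types u v w : GL.

Lemma GL_unitP u : (u : 'M_n) \in unitmx. Proof. exact: (valP u). Qed.

Definition GL_one : GL := MkGL (@unitmx1 k n).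

Lemma GL_mul_subproof u v : (u *m v : 'M_n) \in unitmx.
Proof. by rewrite unitmx_mul !GL_unitP. Qed.
Definition GL_mul u v : GL := MkGL (GL_mul_subproof u v).

Lemma GL_inv_subproof u : invmx u \in unitmx.
Proof. by rewrite unitmx_inv GL_unitP. Qed.
Definition GL_inv u : GL := MkGL (GL_inv_subproof u).

Fact GL_mulA : associative GL_mul.
Proof. by move=> u v w; apply: val_inj; rewrite /= mulmxA. Qed.
Fact GL_mul1 : left_id GL_one GL_mul.
Proof. by move=> u; apply: val_inj; rewrite /= mul1mx. Qed.
Fact GL_mulr1 : right_id GL_one GL_mul.
Proof. by move=> u; apply: val_inj; rewrite /= mulmx1. Qed.
Fact GL_mulV : left_inverse GL_one GL_inv GL_mul.
Proof. by move=> u; apply: val_inj; rewrite /= mulVmx ?GL_unitP. Qed.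
Fact GL_mulrV : right_inverse GL_one GL_inv GL_mul.
Proof. by move=> u; apply: val_inj; rewrite /= mulmxV ?GL_unitP. Qed.

HB.instance Definition _ :=
  isGroup.Build GL GL_mulA GL_mul1 GL_mulr1 GL_mulV GL_mulrV.

Lemma GLmxM u v : (u * v)%g = u *m v :> 'M_n. Proof. by []. Qed.
Lemma GLmxV u : (u^-1)%g = invmx u :> 'M_n. Proof. by []. Qed.
Lemma GLmx1 : (1%g : GL) = 1%:M :> 'M_n. Proof. by []. Qed.

(** [u^-1 v] is scalar, i.e. [u] and [v] have the same coset modulo [k^*]. *)
Definition proj_eq (u v : GL) : bool := is_scalar_mx (u^-1 * v)%g.

Lemma proj_eqP u v :
  reflect (exists2 c : k, c != 0 & v = c *: (u : 'M_n) :> 'M_n) (proj_eq u v).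
Proof.
apply: (iffP is_scalar_mxP) => [[c] | [c _] Ev]; last first.
  by exists c; rewrite GLmxM GLmxV Ev -scalemxAr mulVmx ?GL_unitP // scalemx1.
rewrite GLmxM GLmxV => /(congr1 (mulmx u)).
rewrite mulKVmx ?GL_unitP // mul_mx_scalar => Ev.
have [c0 | ] := eqVneq c 0; last by move=> c0; exists c.
exists 1; rewrite ?oner_eq0 // scale1r.
move: (GL_unitP v) (GL_unitP u); rewrite Ev c0 scale0r.
case: (n) (GLmx u) => [|m] w; first by rewrite [w]flatmx0.
by rewrite unitmxE det0 unitr0.
Qed.

Fact proj_eq_refl : reflexive proj_eq.
Proof. by move=> u; apply/proj_eqP; exists 1; rewrite ?oner_eq0 ?scale1r. Qed.

Fact proj_eq_sym : symmetric proj_eq.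
Proof.
suff H u v : proj_eq u v -> proj_eq v u by move=> u v; apply/idP/idP; apply: H.
case/proj_eqP=> c c0 Ev; apply/proj_eqP; exists c^-1; rewrite ?invr_eq0 //.
by rewrite Ev scalerA mulVf // scale1r.
Qed.

Fact proj_eq_trans : transitive proj_eq.
Proof.
move=> v u w /proj_eqP[c c0 Ev] /proj_eqP[d d0 Ew]; apply/proj_eqP.
by exists (d * c); rewrite ?mulf_neq0 // Ew Ev scalerA.
Qed.

Canonical proj_equiv := EquivRel proj_eq proj_eq_refl proj_eq_sym proj_eq_trans.

Definition PGL := {eq_quot proj_eq}.

HB.instance Definition _ := Choice.on PGL.
HB.instance Definition _ := Quotient.on PGL.
HB.instance Definition _ := EqQuotient.on PGL.

Definition GLclass (u : GL) : PGL := \pi_PGL u.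

Lemma GLclassE u v : GLclass u = GLclass v <->
  exists2 c : k, c != 0 & v = c *: (u : 'M_n) :> 'M_n.
Proof. by split=> [/eqmodP/proj_eqP | /proj_eqP/eqmodP]. Qed.

Definition PGL_one : PGL := GLclass 1%g.
Definition PGL_mul (x y : PGL) : PGL :=
  GLclass (generic_quotient.repr x * generic_quotient.repr y)%g.
Definition PGL_inv (x : PGL) : PGL :=
  GLclass (generic_quotient.repr x)^-1%g.

Lemma GLclass_repr (x : PGL) :
  GLclass (generic_quotient.repr x) = x. Proof. exact: reprK. Qed.

Lemma repr_GLclass u :
  exists2 c : k, c != 0 & generic_quotient.repr (GLclass u) =
     c *: (u : 'M_n) :> 'M_n.
Proof. by apply/GLclassE; rewrite GLclass_repr. Qed.

Lemma PGL_mulE u v : PGL_mul (GLclass u) (GLclass v) = GLclass (u * v)%g.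
Proof.
apply/esym/GLclassE; have [c c0 Eu] := repr_GLclass u.
have [d d0 Ev] := repr_GLclass v; exists (c * d); first exact: mulf_neq0.
by rewrite GLmxM Eu Ev -scalemxAl -scalemxAr scalerA.
Qed.

Lemma PGL_invE u : PGL_inv (GLclass u) = GLclass u^-1%g.
Proof.
apply/esym/GLclassE; have [c c0 Eu] := repr_GLclass u.
exists c^-1; first by rewrite invr_eq0.
by rewrite GLmxV Eu invmxZ // -Eu GL_unitP.
Qed.

Fact PGL_mulA : associative PGL_mul.
Proof.
move=> x y z; rewrite -(GLclass_repr x) -(GLclass_repr y) -(GLclass_repr z).
by rewrite !PGL_mulE mulgA.
Qed.
Fact PGL_mul1 : left_id PGL_one PGL_mul.
Proof. by move=> x; rewrite -(GLclass_repr x) PGL_mulE mul1g. Qed.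
Fact PGL_mulr1 : right_id PGL_one PGL_mul.
Proof. by move=> x; rewrite -(GLclass_repr x) PGL_mulE mulg1. Qed.
Fact PGL_mulV : left_inverse PGL_one PGL_inv PGL_mul.
Proof. by move=> x; rewrite -(GLclass_repr x) PGL_invE PGL_mulE mulVg. Qed.
Fact PGL_mulrV : right_inverse PGL_one PGL_inv PGL_mul.
Proof. by move=> x; rewrite -(GLclass_repr x) PGL_invE PGL_mulE mulgV. Qed.

HB.instance Definition _ :=
  isGroup.Build PGL PGL_mulA PGL_mul1 PGL_mulr1 PGL_mulV PGL_mulrV.

Lemma GLclassM u v : GLclass (u * v)%g = (GLclass u * GLclass v)%g.
Proof. by rewrite -PGL_mulE. Qed.

Lemma GLclassV u : GLclass u^-1%g = (GLclass u)^-1%g.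
Proof. by rewrite -PGL_invE. Qed.

(** Only meaningful on invertible matrices; the others are sent to the neutral
    element. *)
Definition mxclass (M : 'M[k]_n) : PGL := GLclass (insubd (1%g : GL) M).

Lemma mxclass_GL u : mxclass u = GLclass u.
Proof. by rewrite /mxclass valKd. Qed.

Lemma GL_contra_subproof u : (invmx u^T : 'M_n) \in unitmx.
Proof. by rewrite unitmx_inv unitmx_tr GL_unitP. Qed.
(** The contragredient [A'^-1]. *)
Definition GL_contra u : GL := MkGL (GL_contra_subproof u).

Definition kappa (x : PGL) : PGL := GLclass (GL_contra (generic_quotient.repr x)).

Lemma kappaE u : kappa (GLclass u) = GLclass (GL_contra u).
Proof.
apply/esym/GLclassE; have [c c0 Eu] := repr_GLclass u.
exists c^-1; first by rewrite invr_eq0.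
by rewrite /= Eu linearZ /= invmxZ // -linearZ /= unitmx_tr -Eu GL_unitP.
Qed.

Lemma kappaM : {morph kappa : x y / (x * y)%g}.
Proof.
move=> x y; rewrite -(GLclass_repr x) -(GLclass_repr y) -GLclassM !kappaE.
rewrite -GLclassM; congr GLclass; apply: val_inj => /=.
have := congr1 (fun w : GL => (w : 'M_n)^T)
  (invgM (generic_quotient.repr x) (generic_quotient.repr y)).
by rewrite !GLmxV !GLmxM !GLmxV trmx_mul !trmx_inv.
Qed.

Lemma kappaK : involutive kappa.
Proof.
move=> x; rewrite -(GLclass_repr x) !kappaE; congr GLclass; apply: val_inj => /=.
by rewrite trmx_inv invmxK trmxK.
Qed.

End GeneralLinear.

Arguments mxclass {n k} M.
Arguments kappa {n k} x.

Section Representations.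
Variables (n : nat) (k : fieldType) (G : groupType).
Implicit Types (rho : G -> PGL n k) (H K : set (PGL n k)).

Definition faithful_rep rho : Prop := monoid.monoid_morphism rho /\ injective rho.

Definition inner_automorphism (sigma : PGL n k -> PGL n k) : Prop :=
  exists g : PGL n k, forall x, sigma x = (g * x * g^-1)%g.

Definition equivalent rho rho' : Prop :=
  exists2 sigma, inner_automorphism sigma & rho' =1 sigma \o rho.

Definition is_subgroup H : Prop :=
  H 1%g /\ forall x y, H x -> H y -> H (x * y^-1)%g.

Definition isomorphic_to H : Prop :=
  exists f : G -> PGL n k,
    [/\ monoid.monoid_morphism f, injective f & range f = H].

Definition PGL_conjugate H K : Prop :=
  exists g : PGL n k, K = [set (g * x * g^-1)%g | x in H]%classic.

End Representations.

Arguments isomorphic_to {n k} G H.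

Definition SL2F7 : {set {'GL_2['F_7]}} := [set u | \det (GLval u) == 1]%SET.

Fact SL2F7_group_set : group_set SL2F7.
Proof.
apply/group_setP; split; first by rewrite inE GL_1E det1.
by move=> u v; rewrite !inE GL_MxE det_mulmx => /eqP-> /eqP->; rewrite mulr1.
Qed.
Canonical SL2F7_group := Group SL2F7_group_set.

Definition PSL2F7 : finGroupType := [subg (SL2F7 / 'Z(SL2F7)%g)%G].

(** Only meaningful on matrices of determinant [1]; [insubd] and [subg] send the
    others to [1]. *)
Definition PSLclass (M : 'M['F_7]_2) : PSL2F7 :=
  subg (SL2F7 / 'Z(SL2F7)%g)%G (coset 'Z(SL2F7) (insubd (1 : {'GL_2['F_7]}) M))%g.

Definition mx_of_rows (R : nmodType) (m n : nat) (rows : seq (seq R)) :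
  'M[R]_(m, n) := \matrix_(i, j) (nth [::] rows i)`_j.

Definition gen_a : 'M['F_7]_2 := mx_of_rows 2 2 [:: [:: 1; 1]; [:: 0; 1]].
Definition gen_b : 'M['F_7]_2 := mx_of_rows 2 2 [:: [:: 5; 0]; [:: 0; 3]].
Definition gen_c : 'M['F_7]_2 := mx_of_rows 2 2 [:: [:: 0; -1]; [:: 1; 0]].

Fact det_mx_of_rows2 (R : comNzRingType) (x y z t : R) :
  \det (mx_of_rows 2 2 [:: [:: x; y]; [:: z; t]]) = x * t - y * z.
Proof.
rewrite (expand_det_row _ ord0) !big_ord_recl big_ord0 /cofactor !det_mx11.
by rewrite !mxE /= addr0 expr0 expr1 mul1r mulN1r mulrN.
Qed.

Lemma det_gens : [/\ \det gen_a = 1, \det gen_b = 1 & \det gen_c = 1].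
Proof. by split; rewrite det_mx_of_rows2; apply/eqP. Qed.

Lemma val_PSLclass (M : 'M['F_7]_2) : \det M = 1 ->
  exists u : {'GL_2['F_7]},
    [/\ u \in SL2F7, GLval u = M & val (PSLclass M) = coset 'Z(SL2F7)%g u].
Proof.
move=> dM; have uM : M \in GRing.unit by rewrite [_ \in _]unitmxE dM unitr1.
pose u : {'GL_2['F_7]} := Sub M uM; exists u.
have uS : u \in SL2F7 by rewrite inE /= dM.
split=> //; rewrite /PSLclass -[M in insubd _ M](SubK {'GL_2['F_7]} uM) valKd.
by rewrite /= subgK // mem_quotient.
Qed.

Section PaperRepresentations.
Variable k : fieldType.
Implicit Types e s t a b c : k.

Definition mxA e : 'M[k]_4 :=
  mx_of_rows 4 4 [:: [:: e ^+ 4; 0; 0; 0]; [:: 0; e ^+ 2; 0; 0];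
                     [:: 0; 0; e; 0]; [:: 0; 0; 0; 1]].

Definition mxB : 'M[k]_4 :=
  mx_of_rows 4 4 [:: [:: 0; 1; 0; 0]; [:: 0; 0; 1; 0];
                     [:: 1; 0; 0; 0]; [:: 0; 0; 0; 1]].

Definition mxZ t a b c : 'M[k]_4 :=
  mx_of_rows 4 4 [:: [:: a; b; c; t]; [:: b; c; a; t];
                     [:: c; a; b; t]; [:: t; t; t; 1]].

Definition mxC_sqrt2 s e : 'M[k]_4 :=
  mxZ s (e + e ^+ 6) (e ^+ 2 + e ^+ 5) (e ^+ 3 + e ^+ 4).

Definition mxC_0 e : 'M[k]_4 :=
  mxZ 0
    (7^-1 * (- 2 - e + 2 * e ^+ 2 + 2 * e ^+ 5 - e ^+ 6))
    (7^-1 * (- 2 - e ^+ 2 + 2 * e ^+ 3 + 2 * e ^+ 4 - e ^+ 5))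
    (7^-1 * (- 2 + 2 * e - e ^+ 3 - e ^+ 4 + 2 * e ^+ 6)).

Fact mxA_unit e : e != 0 -> mxA e \in unitmx.
Proof.
move=> e0; rewrite unitmxE.
have -> : mxA e = diag_mx (\row_j [:: e ^+ 4; e ^+ 2; e; 1]`_j).
  by apply/matrixP=> -[[|[|[|[|//]]]] ?] -[[|[|[|[|//]]]] ?]; rewrite !mxE.
rewrite det_diag !big_ord_recl big_ord0 !mxE /= unitfE.
by rewrite !mulf_neq0 ?expf_neq0 ?oner_eq0.
Qed.

Fact mxB_unit : mxB \in unitmx.
Proof.
suff /mulmx1_unit[] : mxB *m mxB^T = 1%:M by [].
apply/matrixP=> -[[|[|[|[|//]]]] ?] -[[|[|[|[|//]]]] ?];
  by rewrite !mxE !big_ord_recl big_ord0 !mxE /=; ring.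
Qed.

Fact mxZ_unit t a b c d : d != 0 ->
    a ^+ 2 + b ^+ 2 + c ^+ 2 + t ^+ 2 = d -> a * b + b * c + c * a + t ^+ 2 = 0 ->
    t * (a + b + c + 1) = 0 -> 3 * t ^+ 2 + 1 = d ->
  mxZ t a b c \in unitmx.
Proof.
move=> d0 E1 E2 E3 E4.
suff ZZ : mxZ t a b c *m mxZ t a b c = d%:M.
  have /mulmx1_unit[] // : mxZ t a b c *m (d^-1 *: mxZ t a b c) = 1%:M.
  by rewrite -scalemxAr ZZ scale_scalar_mx mulVf.
apply/matrixP=> -[[|[|[|[|//]]]] ?] -[[|[|[|[|//]]]] ?];
  rewrite !mxE !big_ord_recl big_ord0 !mxE /= ?mulr1n ?mulr0n;
  by [apply: etrans E1; ring | apply: etrans E4; ring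
     | apply: etrans E2; ring | apply: etrans E3; ring].
Qed.

Fact Phi7_root e : 7.-primitive_root e ->
  1 + e + e ^+ 2 + e ^+ 3 + e ^+ 4 + e ^+ 5 + e ^+ 6 = 0.
Proof.
move=> pe; have e1 : e - 1 != 0.
  by rewrite subr_eq0 -[e]expr1 -(prim_order_dvd pe).
apply: (mulfI e1); rewrite mulr0.
transitivity (e ^+ 7 - 1); first by ring.
by rewrite (prim_expr_order pe) subrr.
Qed.

Section Cinvertible.
Hypothesis k0 : [pchar k] =i pred0.
Variable e : k.
Hypothesis pe : 7.-primitive_root e.

Let seven_neq0 : 7 != 0 :> k.
Proof. by rewrite ((pcharf0P k).1 k0). Qed.

Fact mxC_sqrt2_unit s : s ^+ 2 = 2 -> mxC_sqrt2 s e \in unitmx.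
Proof.
move=> s2; apply: (mxZ_unit seven_neq0); rewrite ?s2.
- apply/eqP; rewrite -subr_eq0; apply/eqP.
  rewrite -[RHS](mulr0 (e ^+ 6 - e ^+ 5 + e ^+ 4 - e ^+ 3 + e ^+ 2 + 5 * e - 5)).
  by rewrite -[X in _ = _ * X](Phi7_root pe); ring.
- rewrite -[RHS](mulr0 (e ^+ 5 + e ^+ 3 - 2 * e + 2)).
  by rewrite -[X in _ = _ * X](Phi7_root pe); ring.
- by rewrite -[RHS](mulr0 s) -(Phi7_root pe); ring.
- by ring.
Qed.

Fact mxC_0_unit : mxC_0 e \in unitmx.
Proof.
apply: (mxZ_unit (oner_neq0 k)).
- apply/eqP; rewrite -subr_eq0; apply/eqP.
  rewrite -[RHS](mulr0 (49^-1 * (5 * e ^+ 6 - 9 * e ^+ 5 + 5 * e ^+ 4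
    - 9 * e ^+ 3 + 5 * e ^+ 2 + 33 * e - 37))).
  rewrite -[X in _ = _ * X](Phi7_root pe); field.
  by rewrite ((pcharf0P k).1 k0).
- rewrite -[RHS](mulr0 (49^-1 * (- 2 * e ^+ 6 + 5 * e ^+ 5 - 2 * e ^+ 4
    + 5 * e ^+ 3 - 2 * e ^+ 2 - 16 * e + 12))).
  rewrite -[X in _ = _ * X](Phi7_root pe); field.
  by rewrite ((pcharf0P k).1 k0).
- by rewrite mul0r.
- by ring.
Qed.

End Cinvertible.

Definition rep_with (A B C : 'M[k]_4) (rho : PSL2F7 -> PGL 4 k) : Prop :=
  [/\ faithful_rep rho, rho (PSLclass gen_a) = mxclass A,
      rho (PSLclass gen_b) = mxclass B & rho (PSLclass gen_c) = mxclass C].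

(** The homomorphism specified by [rep_with]: it is unique if it exists, since
    (a), (b), (c) generate.  If there is none, [xget] returns its default, the
    trivial map. *)
Definition the_rep (A B C : 'M[k]_4) : PSL2F7 -> PGL 4 k :=
  xget (fun=> 1%g) [set rho | rep_with A B C rho]%classic.

Definition phi_sqrt2 s e (i : nat) : PSL2F7 -> PGL 4 k :=
  the_rep (mxA (e ^+ i)) mxB (mxC_sqrt2 s (e ^+ i)).

Definition phi_0 e (i : nat) : PSL2F7 -> PGL 4 k :=
  the_rep (mxA (e ^+ i)) mxB (mxC_0 (e ^+ i)).

End PaperRepresentations.

Arguments mxB {k}.

Definition I1 : seq nat := [:: 1; 2; 4]%N.
Definition I2 : seq nat := [:: 3; 5; 6]%N.

(* Main.v *)
(** [PSL_2(F_7)] is presented by the relations [a^7 = b^3 = c^2 = 1], [bab^-1 = a^4],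
    [cbc = b^-1] and [(ac)^3 = 1]: through the Bruhat decomposition they determine all
    products, so elements of a group satisfying them yield a homomorphism, injective
    as soon as the image of [a] is nontrivial.

    Conversely let [A], [B], [C] lift the images of [a], [b], [c] under a faithful
    representation.  After rescaling, [A^7 = 1] and [BA = A^4 B], so the spectrum of
    [A] is stable under squaring and [A] has eigenvalues [e^4, e^2, e, 1] for a
    primitive seventh root [e]; in a suitable basis [A] and [B] are the matrices of the
    paper.  Then [BCB = C] leaves six unknown entries, which [C^2 = D] and
    [CAC = m A^-1 C A^-1] determine up to the centralizer of [A] and [B]: the product
    of the two off-diagonal unknowns is [0] or [2], and each case is linear.

    Conjugation by [B^2] replaces [e] by [e^2]; traces of [A] and [A^2] separate [e]
    from [e^6]. *)

Require Import Defs.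
From mathcomp Require Import all_boot all_order all_fingroup all_algebra.
From mathcomp Require Import all_solvable.
From mathcomp Require Import boolp classical_sets.
From mathcomp Require Import ring.
Set Implicit Arguments.
Unset Strict Implicit.
Unset Printing Implicit Defensive.
Import GRing.Theory.
Local Open Scope ring_scope.

(** * The group [PSL_2(F_7)] *)

Section SpecialLinear.

(** A relation in [PGL] lifts to matrices only up to an unknown scalar, and removing these scalars
    shapes the classification. For [A], one factor has to repair [A^7 = 1] and [BA = A^4 B]
    simultaneously. For [BCB], the scalar is 1 because [B] and [B^2] have the same nonzero trace.
    The remaining two, [D] and [m], are read off the bottom right entries. Everything about [e] is a
    polynomial identity modulo the seventh cyclotomic polynomial, hence uniform in the primitive
    root: the same lemmas serve all six indices. Most constants come from the periods eta = e + e^2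
    + e^4 and etab = e^3 + e^5 + e^6, with sum -1 and product 2; for instance the scalar 2 eta + 1
    attached to the square root of 2 is a square root of -7. The images for indices 1 and 6 coincide
    because the two representations differ by the outer automorphism of [PSL2F7] that inverts (a)
    and fixes (b) and (c). *)

Lemma mx2P (R : nzRingType) (M : 'M[R]_2) :
  M = mx_of_rows 2 2 [:: [:: M 0 0; M 0 1]; [:: M 1 0; M 1 1]].
Proof.
apply/matrixP => -[[|[|//]] ?] -[[|[|//]] ?]; rewrite !mxE /=;
  by congr (M _ _); apply: val_inj.
Qed.

Lemma mulmx2 (R : nzRingType) (p q r s p' q' r' s' : R) :
  mx_of_rows 2 2 [:: [:: p; q]; [:: r; s]] *m
  mx_of_rows 2 2 [:: [:: p'; q']; [:: r'; s']] =
  mx_of_rows 2 2 [:: [:: p * p' + q * r'; p * q' + q * s'];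
                     [:: r * p' + s * r'; r * q' + s * s']].
Proof.
apply/matrixP => -[[|[|//]] ?] -[[|[|//]] ?];
  by rewrite !mxE !big_ord_recl big_ord0 !mxE /= addr0.
Qed.

Lemma oppmx2 (R : nzRingType) (p q r s : R) :
  - mx_of_rows 2 2 [:: [:: p; q]; [:: r; s]] =
  mx_of_rows 2 2 [:: [:: - p; - q]; [:: - r; - s]].
Proof. by apply/matrixP => -[[|[|//]] ?] -[[|[|//]] ?]; rewrite !mxE. Qed.

Lemma det2N (R : comNzRingType) (M : 'M[R]_2) : \det (- M) = \det M.
Proof. by rewrite -scaleN1r detZ sqrrN expr1n mul1r. Qed.

Lemma center_SL2F7 (u : {'GL_2['F_7]}) : u \in SL2F7 ->
  (u \in 'Z(SL2F7)%g) = (GLval u == 1%:M) || (GLval u == - 1%:M).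
Proof.
move=> uS; apply/idP/idP => [/centerP[_ cu]|].
  (* Commuting with [gen_a] gives r = 0 and p = s, commuting with [gen_c] then gives q = 0, and the
     determinant leaves s = 1 or s = -1. *)
  have cM M : \det M = 1 -> GLval u *m M = M *m GLval u.
    move=> dM; have [v [vS <- _]] := val_PSLclass dM.
    by rewrite -!GL_MxE (cu v vS).
  have [da db dc] := det_gens.
  move: uS (cM _ da) (cM _ dc); rewrite inE (mx2P (GLval u)).
  move: (GLval u 0 0) (GLval u 0 1) (GLval u 1 0) (GLval u 1 1) => p q r s.
  rewrite /gen_a /gen_c !mulmx2 det_mx_of_rows2 => /eqP d1 /matrixP Ha /matrixP Hc.
  move: (Ha 0 0) (Ha 0 1); rewrite !mxE /= !(mulr1, mulr0, mul1r, mul0r, addr0).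
  rewrite -{1}[p]addr0 => /addrI/esym r0; rewrite addrC => /addrI ps.
  move: d1 (Hc 0 0); rewrite r0 ps !mxE /=.
  rewrite !(mulr1, mulr0, mul0r, subr0, add0r, mulN1r, addr0) => d1 ->.
  have: (s == 1) || (s == -1).
    by rewrite -[_ || _]eqf_sqr expr1n expr2 d1.
  by case/orP=> /eqP->; apply/orP; [left|right]; apply/eqP/matrixP;
     move=> -[[|[|//]] ?] -[[|[|//]] ?]; rewrite !mxE /= ?oppr0.
move=> Hu; apply/centerP; split=> // v _; apply: val_inj.
rewrite -[LHS]/(GLval (u * v)) -[RHS]/(GLval (v * u)) !GL_MxE.
by case/orP: Hu => /eqP->; rewrite ?mulNmx ?mulmxN mul1mx mulmx1.
Qed.

Lemma PSLclassM (M N : 'M['F_7]_2) : \det M = 1 -> \det N = 1 ->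
  PSLclass (M *m N) = (PSLclass M * PSLclass N)%g.
Proof.
move=> dM dN; have dMN : \det (M *m N) = 1 by rewrite det_mulmx dM dN mulr1.
have [u [uS Eu Hu]] := val_PSLclass dM; have [v [vS Ev Hv]] := val_PSLclass dN.
have [w [wS Ew Hw]] := val_PSLclass dMN.
have nZ := fintype.subsetP (normal_norm (center_normal SL2F7_group)).
apply: val_inj; rewrite /= Hw Hu Hv -morphM ?nZ //; congr (coset _ _).
by apply: val_inj; rewrite /= [LHS]Ew -Eu -Ev.
Qed.

Lemma PSLclass1 : PSLclass 1%:M = 1%g.
Proof.
by apply: (mulgI (PSLclass 1%:M)); rewrite -(PSLclassM (det1 _ _) (det1 _ _)) mulg1 mulmx1.
Qed.

Lemma PSLclass_eq (M N : 'M['F_7]_2) : \det M = 1 -> \det N = 1 ->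
  PSLclass M = PSLclass N -> N = M \/ N = - M.
Proof.
move=> dM dN; have [u [uS Eu Hu]] := val_PSLclass dM.
have [v [vS Ev Hv]] := val_PSLclass dN.
move/(congr1 val); rewrite Hu Hv => /esym/eqP.
have nZ := fintype.subsetP (normal_norm (center_normal SL2F7_group)).
move/eqP/(kercoset_rcoset (nZ _ vS) (nZ _ uS)) => [z zZ /(congr1 GLval)].
have zS := fintype.subsetP (center_sub SL2F7_group) _ zZ.
rewrite GL_MxE Eu Ev => ->; move: zZ; rewrite center_SL2F7 //.
by case/orP=> /eqP->; [left | right]; rewrite ?mulNmx mul1mx.
Qed.

Lemma PSLclassN (M : 'M['F_7]_2) : \det M = 1 -> PSLclass (- M) = PSLclass M.
Proof.
move=> dM; have d1 : \det (- 1%:M : 'M['F_7]_2) = 1 by rewrite det2N det1.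
rewrite -[M in - M]mul1mx -mulNmx PSLclassM // -[RHS]mul1g; congr (_ * _)%g.
have [u [uS Eu Hu]] := val_PSLclass d1; apply: val_inj; rewrite /= Hu.
by apply: coset_id; rewrite center_SL2F7 // Eu eqxx orbT.
Qed.

Lemma PSLclass_surj (x : PSL2F7) :
  exists2 M : 'M['F_7]_2, \det M = 1 & x = PSLclass M.
Proof.
have /morphimP[u nu uS Eu] := valP x.
have d1 : \det (GLval u) = 1 by move: uS; rewrite inE => /eqP.
exists (GLval u) => //; have [v [vS Ev Hv]] := val_PSLclass d1.
by apply: val_inj; rewrite /= Hv [LHS]Eu; congr (coset _ _); apply: val_inj.
Qed.

End SpecialLinear.

(** * Homomorphisms from the Bruhat decomposition *)

(** The Bruhat decomposition as an induction principle: a matrix is U T if its lower left entry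
    vanishes and U T w U otherwise. A map on SL_2 is thus multiplicative as soon as it respects
    right multiplication by the three kinds of factors. *)
Lemma SL2_ind (F : fieldType) (P : 'M[F]_2 -> Prop) :
    P 1%:M ->
    (forall M x, \det M = 1 -> P M ->
       P (M *m mx_of_rows 2 2 [:: [:: 1; x]; [:: 0; 1]])) ->
    (forall M t, t != 0 -> \det M = 1 -> P M ->
       P (M *m mx_of_rows 2 2 [:: [:: t; 0]; [:: 0; t^-1]])) ->
    (forall M, \det M = 1 -> P M ->
       P (M *m mx_of_rows 2 2 [:: [:: 0; -1]; [:: 1; 0]])) ->
  forall M, \det M = 1 -> P M.
Proof.
move=> P1 PU PT Pw M; rewrite (mx2P M) det_mx_of_rows2.
move: (M 0 0) (M 0 1) (M 1 0) (M 1 1) => {M} p q r s d1.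
pose mx2 p q r s : 'M[F]_2 := mx_of_rows 2 2 [:: [:: p; q]; [:: r; s]].
have dU x : \det (mx2 1 x 0 1) = 1 by rewrite det_mx_of_rows2; ring.
have dT t : t != 0 -> \det (mx2 t 0 0 t^-1) = 1.
  by move=> t0; rewrite det_mx_of_rows2; field.
have dw : \det (mx2 0 (-1) 1 0) = 1 by rewrite det_mx_of_rows2; ring.
have PU1 x : P (mx2 1 x 0 1) by rewrite -[mx2 _ _ _ _]mul1mx; apply: PU; rewrite ?det1.
have [r0 | r0] := eqVneq r 0.
  have ps : p * s = 1 by rewrite -d1 r0; ring.
  have p0 : p != 0 by apply: contra_eq_neq ps => ->; rewrite mul0r eq_sym oner_eq0.
  have -> : mx_of_rows 2 2 [:: [:: p; q]; [:: r; s]] =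
            mx2 1 (q * p) 0 1 *m mx2 p 0 0 p^-1.
    rewrite mulmx2 r0 !(mulr0, mul0r, mul1r, addr0, add0r) mulfK //.
    by rewrite -[s](mulKf p0) ps mulr1.
  exact: PT.
have -> : mx_of_rows 2 2 [:: [:: p; q]; [:: r; s]] =
    mx2 1 (p / r) 0 1 *m mx2 r^-1 0 0 r^-1^-1 *m mx2 0 (-1) 1 0 *m mx2 1 (s / r) 0 1.
  have -> : q = (p * s - 1) / r by apply: (mulIf r0); rewrite -d1; field.
  by rewrite !mulmx2 !invrK; congr (mx2 _ _ _ _); field; rewrite r0.
have rV0 : r^-1 != 0 by rewrite invr_eq0.
by apply: PU; [|apply: Pw; [|apply: PT]]; rewrite ?det_mulmx ?dU ?dT ?dw ?mulr1.
Qed.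

Section BruhatMorphism.
Variables (F : fieldType) (H : groupType) (U T : F -> H) (w : H).
Hypothesis UD : forall x y, U (x + y) = (U x * U y)%g.
Hypothesis TM : forall s t : F, s != 0 -> t != 0 -> T (s * t) = (T s * T t)%g.
Hypothesis TN1 : T (-1) = 1%g.
Hypothesis TU : forall t x : F, t != 0 -> (T t * U x = U (t ^+ 2 * x) * T t)%g.
Hypothesis ww : (w * w = 1)%g.
Hypothesis wT : forall t : F, t != 0 -> (w * T t = T t^-1 * w)%g.
Hypothesis wUw : forall y : F, y != 0 ->
  (w * U y * w = U (- y^-1) * T y^-1 * w * U (- y^-1))%g.

(** The Bruhat normal form of a matrix of determinant 1, evaluated in [H]. The hypothesis [wUw] is
    the same normal form for w U(y) w, which is the matrix with rows (-1, 0) and (y, -1). *)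
Definition bruhat_map (M : 'M[F]_2) : H :=
  let: (p, q, r, s) := (M 0 0, M 0 1, M 1 0, M 1 1) in
  if r == 0 then (U (q * p) * T p)%g
  else (U (p / r) * T r^-1 * w * U (s / r))%g.

Local Notation mx2 p q r s := (mx_of_rows 2 2 [:: [:: p; q]; [:: r; s]]).

Lemma bruhat_mapE p q r s : bruhat_map (mx2 p q r s) =
  if r == 0 then (U (q * p) * T p)%g
  else (U (p / r) * T r^-1 * w * U (s / r))%g.
Proof. by rewrite /bruhat_map !mxE /=. Qed.

Let U0 : U 0 = 1%g.
Proof. by apply: (mulgI (U 0)); rewrite -UD addr0 mulg1. Qed.

Let T1 : T 1 = 1%g.
Proof. by apply: (mulgI (T 1)); rewrite -TM ?oner_eq0 // mulr1 mulg1. Qed.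

Let TN t : t != 0 -> T (- t) = T t.
Proof. by move=> t0; rewrite -mulN1r TM ?oppr_eq0 ?oner_eq0 // TN1 mul1g. Qed.

Lemma bruhat_mapN M : \det M = 1 -> bruhat_map (- M) = bruhat_map M.
Proof.
rewrite (mx2P M) oppmx2 det_mx_of_rows2 !bruhat_mapE oppr_eq0 !invrN !mulrNN.
move: (M 0 0) (M 0 1) (M 1 0) (M 1 1) => p q r s d1.
have [r0 | r0] := eqVneq r 0; last by rewrite TN ?invr_eq0.
rewrite TN //; apply: contra_eq_neq d1 => ->.
by rewrite mul0r r0 mulr0 subrr eq_sym oner_eq0.
Qed.

Lemma bruhat_mapU M x : \det M = 1 ->
  bruhat_map (M *m mx2 1 x 0 1) = (bruhat_map M * U x)%g.
Proof.
rewrite (mx2P M) mulmx2 det_mx_of_rows2 !bruhat_mapE !(mulr1, mulr0, addr0).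
move: (M 0 0) (M 0 1) (M 1 0) (M 1 1) => p q r s d1.
have [r0 | r0] := eqVneq r 0.
  have p0 : p != 0.
    by apply: contra_eq_neq d1 => ->; rewrite r0 !(mul0r, mulr0, subrr) eq_sym oner_eq0.
  by rewrite -mulgA TU // mulgA -UD; congr (U _ * _)%g; ring.
by rewrite -[RHS]mulgA -UD; congr (_ * U _)%g; field.
Qed.

Lemma bruhat_mapT M t : \det M = 1 -> t != 0 ->
  bruhat_map (M *m mx2 t 0 0 t^-1) = (bruhat_map M * T t)%g.
Proof.
rewrite (mx2P M) mulmx2 det_mx_of_rows2 !bruhat_mapE !(mulr0, addr0, add0r).
move: (M 0 0) (M 0 1) (M 1 0) (M 1 1) => p q r s d1 t0.
rewrite mulf_eq0 (negPf t0) orbF.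
have [r0 | r0] := eqVneq r 0.
  have p0 : p != 0.
    by apply: contra_eq_neq d1 => ->; rewrite r0 !(mul0r, mulr0, subrr) eq_sym oner_eq0.
  by rewrite -mulgA -TM //; congr (U _ * _)%g; field.
have ->: (U (p / r) * T r^-1 * w * U (s / r) * T t
          = U (p / r) * (T r^-1 * T t^-1) * w * U (s / t / (r * t)))%g.
  rewrite -!mulgA [in RHS](mulgA (T t^-1)) -wT // -[in RHS]mulgA.
  rewrite TU //; congr (_ * (_ * (_ * (U _ * _))))%g.
  by field; rewrite ?r0 ?t0.
rewrite -TM ?invr_eq0 // -invfM; congr (U _ * _ * _ * _)%g.
by field; rewrite ?r0 ?t0.
Qed.

(** The lower left entry of M w is s. So w moves the Borel subgroup into the big cell when r = 0,
    returns to it when s = 0, and otherwise stays in the big cell, where [wUw] rewrites the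
    product. *)
Lemma bruhat_mapw M : \det M = 1 ->
  bruhat_map (M *m mx2 0 (-1) 1 0) = (bruhat_map M * w)%g.
Proof.
rewrite (mx2P M) mulmx2 det_mx_of_rows2 !bruhat_mapE.
rewrite !(mulr0, mulr1, addr0, add0r, mulrN1).
move: (M 0 0) (M 0 1) (M 1 0) (M 1 1) => p q r s d1.
have [r0 | r0] := eqVneq r 0.
  have ps : p * s = 1 by rewrite -d1 r0; ring.
  have s0 : s != 0 by apply: contra_eq_neq ps => ->; rewrite mulr0 eq_sym oner_eq0.
  rewrite (negPf s0) r0 oppr0 mul0r U0 mulg1.
  have -> : s^-1 = p by apply: (mulIf s0); rewrite mulVf.
  by congr (U _ * _ * _)%g; apply: (mulIf s0); rewrite -mulrA ps; field.
have [s0 | s0] := eqVneq s 0.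
  rewrite s0 mul0r U0 mulg1 -mulgA ww mulg1.
  have -> : q = - r^-1.
    by apply: (mulIf r0); rewrite mulNr mulVf // -d1 s0; ring.
  by rewrite TN ?invr_eq0 // mulrNN.
have sr0 : s / r != 0 by rewrite mulf_neq0 ?invr_eq0.
have -> : (U (p / r) * T r^-1 * w * U (s / r) * w =
  U (p / r + r^-1 ^+ 2 * - (s / r)^-1) * T (r^-1 * (s / r)^-1) * w
    * U (- (s / r)^-1))%g.
  rewrite UD TM ?invr_eq0 // -!mulgA [(w * (U (s / r) * w))%g]mulgA wUw //.
  by rewrite -!mulgA; congr (_ * _)%g; rewrite !mulgA TU ?invr_eq0.
have qE : q = (p * s - 1) / r by apply: (mulIf r0); rewrite -d1; field.
by congr (U _ * T _ * w * U _)%g; rewrite ?qE; field; rewrite ?r0 ?s0.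
Qed.

Lemma bruhat_mapM M N : \det M = 1 -> \det N = 1 ->
  bruhat_map (M *m N) = (bruhat_map M * bruhat_map N)%g.
Proof.
move=> dM dN; elim/SL2_ind: N / dN => [|N x dN IH|N t t0 dN IH|N dN IH].
- have -> : bruhat_map 1%:M = 1%g; last by rewrite mulmx1 mulg1.
  by rewrite (mx2P 1%:M) bruhat_mapE !mxE /= eqxx mul0r U0 T1 mulg1.
- by rewrite mulmxA !bruhat_mapU ?det_mulmx ?dM ?dN ?mul1r // IH mulgA.
- by rewrite mulmxA !bruhat_mapT ?det_mulmx ?dM ?dN ?mul1r // IH mulgA.
- by rewrite mulmxA !bruhat_mapw ?det_mulmx ?dM ?dN ?mul1r // IH mulgA.
Qed.

End BruhatMorphism.

(** * The presentation of PSL_2(F_7) *)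

Section PSL2F7Presentation.

(** The logarithm to the base [5] on [F_7^* / {1, -1}], which is cyclic of order [3];
    the value at [0] is junk. *)
Definition log5 (t : 'F_7) : nat := nth 0%N [:: 0; 0; 1; 2; 2; 1; 0]%N t.

Lemma F7_ind (P : 'F_7 -> Prop) :
  (forall i : nat, (i < 7)%N -> P i%:R) -> forall x, P x.
Proof. by move=> H x; have := H x (ltn_ord x); rewrite natr_Zp. Qed.

Lemma log5M (s t : 'F_7) : s != 0 -> t != 0 ->
  log5 (s * t) = log5 s + log5 t %[mod 3].
Proof.
by elim/F7_ind: s => [] [|[|[|[|[|[|[|//]]]]]]] _;
   elim/F7_ind: t => [] [|[|[|[|[|[|[|//]]]]]]] _.
Qed.

(** Conjugation by the torus element t scales the unipotent parameter by t^2. As [gen_b] is the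
    torus element 5 and 5^2 = 4, this is the relation b a = a^4 b iterated [log5 t] times. *)
Lemma expn4_log5 (t : 'F_7) : t != 0 -> t ^+ 2 = (4 ^ log5 t)%:R.
Proof.
by elim/F7_ind: t => [] [|[|[|[|[|[|[|//]]]]]]] _ // _; apply/eqP.
Qed.

(** The last equation is (ac)^3 = 1. Only positive powers occur, so each relation lifts to an
    identity of matrices without inverses. *)
Definition PSL2F7_relations (H : groupType) (a b c : H) : Prop :=
  [/\ (a ^+ 7 = 1)%g, (b ^+ 3 = 1)%g, (c * c = 1)%g &
   [/\ (b * a = a ^+ 4 * b)%g, (c * b * c = b ^+ 2)%g
     & (c * a * c = a ^+ 6 * c * a ^+ 6)%g]].

Lemma expg_modn (H : groupType) (x : H) m n i : (x ^+ n = 1)%g ->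
  m = i %[mod n] -> (x ^+ m = x ^+ i)%g.
Proof.
move=> xn Emi; rewrite (divn_eq m n) (divn_eq i n) !expgD ![(_ * n)%N]mulnC.
by rewrite !expgM xn !expg1n Emi.
Qed.

Variables (H : groupType) (A B C : H).
Hypothesis relABC : PSL2F7_relations A B C.

Let A7 : (A ^+ 7 = 1)%g. Proof. by case: relABC. Qed.
Let B3 : (B ^+ 3 = 1)%g. Proof. by case: relABC. Qed.
Let C2 : (C * C = 1)%g. Proof. by case: relABC. Qed.
Let BA : (B * A = A ^+ 4 * B)%g. Proof. by case: relABC => _ _ _ []. Qed.

Let CB : (C * B = B^-1 * C)%g.
Proof.
have [_ _ _ [_ CBC _]] := relABC.
have -> : (B^-1 = B ^+ 2)%g by apply: (mulgI B); rewrite mulgV -expgS.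
by rewrite -CBC -mulgA C2 mulg1.
Qed.

Let CAC : (C * A * C = A^-1 * C * A^-1)%g.
Proof.
have -> : (A^-1 = A ^+ 6)%g by apply: (mulgI A); rewrite mulgV -expgS.
by case: relABC => _ _ _ [].
Qed.

Let BjAi j i : (B ^+ j * A ^+ i = A ^+ (4 ^ j * i) * B ^+ j)%g.
Proof.
have BAi m : (B * A ^+ m = A ^+ (4 * m) * B)%g.
  elim: m => [|m IHm]; first by rewrite muln0 mulg1 mul1g.
  by rewrite expgSr mulgA IHm -mulgA BA mulgA -expgD mulnS addnC.
elim: j => [|j IHj]; first by rewrite mul1n mul1g mulg1.
by rewrite expgS -mulgA IHj mulgA BAi expnS -mulgA mulnA.
Qed.

Section Nontrivial.
Hypothesis A1 : A != 1%g.

Lemma expA_eq1 n : (A ^+ n = 1)%g -> (7 %| n)%N.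
Proof.
rewrite (expg_modn (i := n %% 7) A7) ?modn_mod // /dvdn => An.
have inv u : (n %% 7 * u = 1 %[mod 7])%N -> A = 1%g.
  by move/(expg_modn A7); rewrite expgM An expg1n.
have := ltn_pmod n (isT : 0 < 7)%N; move: An inv (elimN eqP A1).
case: (n %% 7)%N => [|[|[|[|[|[|[|//]]]]]]] // _ inv A0 _; case: A0.
(* The inverses of 2, 3, 4, 5, 6 modulo 7. *)
- exact: (inv 4%N).
- exact: (inv 5%N).
- exact: (inv 2%N).
- exact: (inv 3%N).
- exact: (inv 6%N).
Qed.

(** Here [B ^+ j] is a power of [A], so it centralizes [A]; but it conjugates [A] to its power of
    exponent 4^j, and 4 has order 3 modulo 7. *)
Lemma expAB_eq1 i j : (A ^+ i * B ^+ j = 1)%g -> ((7 %| i) && (3 %| j))%N.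
Proof.
move=> E; have dj : (3 %| j)%N.
  have A4j : (A ^+ (4 ^ j) = A)%g.
    have BjA : (B ^+ j * A = A ^+ (4 ^ j) * B ^+ j)%g by rewrite -[A]expg1 BjAi muln1.
    by rewrite -[LHS]mulg1 -E mulgA -expgD addnC expgD -mulgA -BjA mulgA E mul1g.
  have : (7 %| 4 ^ j - 1)%N.
    by apply: expA_eq1; apply: (mulIg A); rewrite -expgSr -subSn ?expn_gt0 // subn1 mul1g.
  have -> : (4 ^ j = 64 ^ (j %/ 3) * 4 ^ (j %% 3))%N.
    by rewrite {1}(divn_eq j 3) expnD mulnC [(_ * 3)%N]mulnC expnM mulnC.
  rewrite -eqn_mod_dvd ?muln_gt0 ?expn_gt0 // -modnMml -modnXm exp1n modnMml mul1n /dvdn.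
  by have := ltn_pmod j (isT : 0 < 3)%N; case: (j %% 3)%N => [|[|[|]]].
have Bj : (B ^+ j = 1)%g by have /dvdnP[m ->] := dj; rewrite mulnC expgM B3 expg1n.
by rewrite dj andbT; apply: expA_eq1; rewrite Bj mulg1 in E.
Qed.

(** A solution would place the involution [C] in the group of odd order [21]
    generated by [A] and [B]. *)
Lemma big_cell_neq1 i j l : (A ^+ i * B ^+ j * C * A ^+ l)%g != 1%g.
Proof.
apply/negP => /eqP E.
have E1 : (A ^+ l * (A ^+ i * B ^+ j * C) = 1)%g.
  by apply: (mulIg (A ^+ l)%g); rewrite -mulgA E mulg1 mul1g.
have EC : (A ^+ (l + i) * B ^+ j = C)%g.
  by apply: (mulIg C); rewrite C2 -E1 expgD !mulgA.
have /expAB_eq1/andP[] : (A ^+ (l + i + 4 ^ j * (l + i)) * B ^+ (j + j) = 1)%g.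
  rewrite -C2 -EC [RHS]mulgA -(mulgA (A ^+ (l + i))%g (B ^+ j)%g) BjAi.
  by rewrite mulgA -expgD -mulgA -expgD.
rewrite addnn -mul2n Gauss_dvdr // => _ dj.
have Bj : (B ^+ j = 1)%g by have /dvdnP[m ->] := dj; rewrite mulnC expgM B3 expg1n.
rewrite Bj mulg1 in EC.
have C1 : C = 1%g.
  have : (7 %| 2 * (l + i))%N by apply: expA_eq1; rewrite mul2n -addnn expgD EC.
  by rewrite Gauss_dvdr // -EC => /dvdnP[m ->]; rewrite mulnC expgM A7 expg1n.
(* With [C] trivial, [CAC] reads A = A^-2, that is A^3 = 1. *)
have : (7 %| 3)%N; last by [].
apply: expA_eq1; move: CAC; rewrite C1 mul1g !mulg1 => EA.
by rewrite 2!expgS expg1 {1}EA -mulgA mulKg mulVg.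
Qed.

End Nontrivial.

(** Locked, since rewriting modulo conversion would otherwise unfold the powers. *)
Definition upow (x : 'F_7) : H := locked (A ^+ x)%g.
Definition tpow (t : 'F_7) : H := locked (B ^+ log5 t)%g.

Arguments upow x%_R.
Arguments tpow t%_R.

Lemma upowE x : upow x = (A ^+ x)%g. Proof. by rewrite /upow -lock. Qed.
Lemma tpowE t : tpow t = (B ^+ log5 t)%g. Proof. by rewrite /tpow -lock. Qed.

Lemma upow_nat i : upow i%:R = (A ^+ i)%g.
Proof. by rewrite upowE; apply: (expg_modn A7); rewrite val_Fp_nat // modn_mod. Qed.

Lemma upowD x y : upow (x + y) = (upow x * upow y)%g.
Proof. by rewrite !upowE -expgD; apply: (expg_modn A7); rewrite /= modn_mod. Qed.

Lemma upow0 : upow 0 = 1%g. Proof. by rewrite upowE. Qed.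

Lemma upowN x : upow (- x) = (upow x)^-1%g.
Proof.
by apply: (mulgI (upow x)); rewrite mulgV -upowD subrr upow0.
Qed.

Lemma tpowM s t : s != 0 -> t != 0 -> tpow (s * t) = (tpow s * tpow t)%g.
Proof. by move=> s0 t0; rewrite !tpowE -expgD; apply: (expg_modn B3); rewrite log5M. Qed.

Lemma tpowU t x : t != 0 -> (tpow t * upow x = upow (t ^+ 2 * x) * tpow t)%g.
Proof.
move=> t0; rewrite expn4_log5 // -[x in RHS]natr_Zp -natrM upow_nat upowE tpowE; exact: BjAi.
Qed.

Lemma tpowV t : t != 0 -> tpow t^-1 = (tpow t)^-1%g.
Proof.
by move=> t0; apply/(mulgI (tpow t)); rewrite mulgV -tpowM ?invr_eq0 // mulfV // tpowE.
Qed.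

Lemma wtpow t : t != 0 -> (C * tpow t = tpow t^-1 * C)%g.
Proof.
move=> t0; rewrite tpowV // tpowE; elim: (log5 t) => [|j IHj].
  by rewrite invg1 mul1g mulg1.
by rewrite [in LHS]expgSr mulgA IHj -mulgA CB mulgA [in RHS]expgS invMg.
Qed.

(** -1 is not a square modulo 7. This reduces the relation for w U(y) w to y = 1, the only case
    among the given relations. *)
Lemma F7_sqr (y : 'F_7) : y != 0 -> exists2 t, t != 0 & y = t ^+ 2 \/ y = - t ^+ 2.
Proof.
move=> y0; suff [i]: exists i : 'F_7, (i != 0) && ((y == i ^+ 2) || (y == - i ^+ 2)).
  by case/andP=> i0 /orP[] /eqP->; exists i => //; [left | right].
elim/F7_ind: y y0 => [] [|[|[|[|[|[|[|//]]]]]]] _ // _;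
  by [exists 1 | exists 2 | exists 3].
Qed.

Lemma tpowN t : tpow (- t) = tpow t.
Proof.
rewrite !tpowE; congr (_ ^+ _)%g.
by elim/F7_ind: t => [] [|[|[|[|[|[|[|//]]]]]]] _. Qed.

Let upow1 : upow 1 = A. Proof. by rewrite upowE. Qed.
Let upowN1 : upow (-1) = A^-1%g. Proof. by rewrite upowN upow1. Qed.

(** For y = t^2, [CAC] is conjugated by the torus element t, which [C] inverts. For y = -t^2, both
    sides of that case are inverted, and [C] is moved back across the torus. *)
Lemma wuw y : y != 0 ->
  (C * upow y * C = upow (- y^-1) * tpow y^-1 * C * upow (- y^-1))%g.
Proof.
case/F7_sqr => t t0 Ey; have tV0 : t^-1 != 0 by rewrite invr_eq0.
have t20 : t ^+ 2 != 0 by rewrite expf_neq0.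
have sq : (C * upow (t ^+ 2) * C =
    upow (- (t ^+ 2)^-1) * tpow (t ^+ 2)^-1 * C * upow (- (t ^+ 2)^-1))%g.
  have -> : upow (t ^+ 2) = (tpow t * A * tpow t^-1)%g.
    by rewrite -[t ^+ 2]mulr1 tpowV // -upow1 tpowU // mulgK.
  rewrite !mulgA wtpow // -!mulgA -{2}[t]invrK -wtpow // invrK //.
  rewrite !mulgA -2!(mulgA (tpow t^-1)) CAC -upowN1 !mulgA tpowU // exprVn mulrN1.
  have Um : (upow (-1) * tpow t = tpow t * upow (- (t ^+ 2)^-1))%g.
    by rewrite tpowU // mulrN mulfV.
  rewrite -(mulgA _ (upow (-1))) Um !mulgA -(mulgA _ C) wtpow // -!mulgA.
  by rewrite (mulgA (tpow _)) -tpowM // -invfM -expr2.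
case: Ey => [-> | ->]; first exact: sq.
have CV : C^-1%g = C by apply: (mulgI C); rewrite mulgV.
move/(congr1 invg): sq; rewrite upowN invrN opprK tpowN upowN !invMg !invgK !CV.
rewrite mulgA => ->; rewrite -tpowV ?invr_eq0 // invrK [(C * (_ * _))%g]mulgA.
by rewrite wtpow // !mulgA.
Qed.

Lemma PSL2F7_presentation : exists rho : PSL2F7 -> H,
  [/\ monoid.monoid_morphism rho,
      [/\ rho (PSLclass gen_a) = A, rho (PSLclass gen_b) = B
        & rho (PSLclass gen_c) = C]
    & A != 1%g -> injective rho].
Proof.
have TN1 : tpow (-1) = 1%g by rewrite tpowN tpowE.
pose f := bruhat_map upow tpow C.
have fN M : \det M = 1 -> f (- M) = f M.
  by apply: bruhat_mapN; [exact: tpowM | exact: TN1].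
have fM M N : \det M = 1 -> \det N = 1 -> f (M *m N) = (f M * f N)%g.
  apply: bruhat_mapM; [exact: upowD | exact: tpowM | exact: TN1 | exact: tpowU
    | exact: C2 | exact: wtpow | exact: wuw].
have surj x : exists M, \det M = 1 /\ x = PSLclass M.
  by have [M] := PSLclass_surj x; exists M.
(* The representative [r x] is determined up to sign, and [f] does not see the sign. *)
have [r rP] := boolp.choice surj.
have [rho rhoE] : exists rho, forall M, \det M = 1 -> rho (PSLclass M) = f M.
  exists (f \o r) => M dM; have [d1 E1] := rP (PSLclass M); rewrite /=.
  by have [->|->] := PSLclass_eq dM d1 E1; rewrite ?fN.
have rhoM : {morph rho : x y / (x * y)%g}.
  move=> x y; have [dx Ex] := rP x; have [dy Ey] := rP y.
  move: (r x) (r y) dx dy Ex Ey => M N dM dN -> ->.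
  rewrite -(PSLclassM dM dN) rhoE ?det_mulmx ?dM ?dN ?mulr1 //.
  by rewrite (fM _ _ dM dN) (rhoE _ dM) (rhoE _ dN).
have rho1 : rho 1%g = 1%g by apply: (mulgI (rho 1%g)); rewrite -rhoM !mulg1.
exists rho; split=> //.
  have [da db dc] := det_gens.
  by split; [rewrite (rhoE _ da) | rewrite (rhoE _ db) | rewrite (rhoE _ dc)];
    rewrite /f bruhat_mapE /= !upowE !tpowE ?expg0 ?mul1g ?mulg1.
(* No big cell element maps to 1. For an element of the Borel subgroup, triviality of the image
   forces 7 to divide the unipotent exponent and 3 to divide [log5 p], hence q = 0 and p = 1 or p =
   -1. *)
move=> A1; have ker x : rho x = 1%g -> x = 1%g.
  have [M] := PSLclass_surj x => dM ->; rewrite rhoE // /f.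
  move: dM; rewrite (mx2P M) det_mx_of_rows2 bruhat_mapE.
  move: (M 0 0) (M 0 1) (M 1 0) (M 1 1) => p q r0 s.
  have [-> | _] := eqVneq r0 0; last first.
    by rewrite !upowE tpowE => _ /eqP; rewrite (negPf (big_cell_neq1 A1 _ _ _)).
  rewrite upowE tpowE mulr0 subr0 => ps /(expAB_eq1 A1)/andP[dqp dp].
  have p0 : p != 0 by apply: contra_eq_neq ps => ->; rewrite mul0r eq_sym oner_eq0.
  have q0 : q = 0.
    apply: (mulIf p0); rewrite mul0r -[LHS]natr_Zp; apply/eqP.
    by rewrite -(dvdn_pcharf (pchar_Fp (isT : prime 7))).
  have : (p == 1) || (p == -1).
    by move: {ps q0 dqp} p p0 dp => p; elim/F7_ind: p => [] [|[|[|[|[|[|[|//]]]]]]] _.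
  have I1 : mx_of_rows 2 2 [:: [:: 1; 0]; [:: 0; 1]] = 1%:M :> 'M['F_7]_2.
    by apply/matrixP => -[[|[|//]] ?] -[[|[|//]] ?]; rewrite !mxE.
  case/orP=> /eqP Ep; move: ps; rewrite Ep q0 (mul1r, mulN1r) => Es.
    by rewrite Es I1 PSLclass1.
  have -> : mx_of_rows 2 2 [:: [:: -1; 0]; [:: 0; s]] = - 1%:M :> 'M['F_7]_2.
    by rewrite -I1 oppmx2 oppr0 -[s]opprK Es.
  by rewrite PSLclassN ?det1 // PSLclass1.
move=> x y Exy; apply/eqP; rewrite -[_ == _](inj_eq (mulgI x^-1%g)) mulVg eq_sym.
apply/eqP/ker; rewrite rhoM -Exy.
by rewrite -rhoM mulVg rho1.
Qed.

End PSL2F7Presentation.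

(** * Relations and generation by (a), (b), (c) *)

Section PSL2F7Generators.

Local Notation unip x := (mx_of_rows 2 2 [:: [:: 1; x]; [:: 0; 1]] : 'M['F_7]_2).
Local Notation tor t u := (mx_of_rows 2 2 [:: [:: t; 0]; [:: 0; u]] : 'M['F_7]_2).

Lemma PSLclass_unip i : PSLclass (unip i%:R) = (PSLclass gen_a ^+ i)%g.
Proof.
have dU x : \det (unip x) = 1 by rewrite det_mx_of_rows2; ring.
have [da _ _] := det_gens.
have U0 : PSLclass (unip 0) = 1%g.
  apply: (mulgI (PSLclass gen_a)); rewrite -(PSLclassM da (dU 0)) mulg1.
  by congr PSLclass; rewrite mulmx2; congr mx_of_rows; rewrite !(mulr0, mulr1, addr0, add0r).
elim: i => [|i IHi]; first by rewrite U0.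
rewrite expgS -IHi -(PSLclassM da (dU _)); congr PSLclass.
rewrite mulmx2 -natr1 !(mulr0, mulr1, mul0r, mul1r, addr0, add0r).
by [].
Qed.

Lemma PSLclass_tor i : PSLclass (tor (5 ^+ i) (3 ^+ i)) = (PSLclass gen_b ^+ i)%g.
Proof.
have dT j : \det (tor (5 ^+ j) (3 ^+ j)) = 1.
  by rewrite det_mx_of_rows2 mulr0 subr0 -exprMn [5 * 3](_ : _ = 1) ?expr1n //; apply/eqP.
have [_ db _] := det_gens.
have T0 : PSLclass (tor (5 ^+ 0) (3 ^+ 0)) = 1%g.
  apply: (mulgI (PSLclass gen_b)); rewrite -(PSLclassM db (dT 0%N)) mulg1.
  by congr PSLclass; rewrite mulmx2 !(mulr0, mul0r, expr0, mulr1, addr0, add0r).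
elim: i => [|i IHi]; first by rewrite T0.
rewrite expgS -IHi -(PSLclassM db (dT _)); congr PSLclass.
by rewrite mulmx2 !(mulr0, mulr1, mul0r, mul1r, addr0, add0r) -!exprS.
Qed.

Local Notation a := (PSLclass gen_a).
Local Notation b := (PSLclass gen_b).
Local Notation c := (PSLclass gen_c).

(** In SL_2 the elements b^3 and c^2 are -1, so these two relations hold only modulo the center; the
    others hold already for matrices. *)
Lemma PSLclass_relations : PSL2F7_relations a b c.
Proof.
have [da db dc] := det_gens.
have dU x : \det (unip x) = 1 by rewrite det_mx_of_rows2; ring.
have dT j : \det (tor (5 ^+ j) (3 ^+ j)) = 1.
  by rewrite det_mx_of_rows2 mulr0 subr0 -exprMn [5 * 3](_ : _ = 1) ?expr1n //; apply/eqP.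
have PN1 : PSLclass (- 1%:M) = 1%g by rewrite (PSLclassN (det1 _ _)) PSLclass1.
have eqmx2 (p q r s p1 q1 r1 s1 : 'F_7) :
    [&& p == p1, q == q1, r == r1 & s == s1] ->
    mx_of_rows 2 2 [:: [:: p; q]; [:: r; s]] =
    mx_of_rows 2 2 [:: [:: p1; q1]; [:: r1; s1]].
  by case/and4P=> /eqP-> /eqP-> /eqP-> /eqP->.
have I1 : mx_of_rows 2 2 [:: [:: 1; 0]; [:: 0; 1]] = 1%:M :> 'M['F_7]_2.
  by apply/matrixP => -[[|[|//]] ?] -[[|[|//]] ?]; rewrite !mxE.
split; last split.
- rewrite -(PSLclass_unip 7) -[RHS]PSLclass1 -I1; congr PSLclass; exact: eqmx2.
- rewrite -(PSLclass_tor 3) -[RHS]PN1 -I1 oppmx2.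
  by congr PSLclass; apply: eqmx2.
- rewrite -(PSLclassM dc dc) -[RHS]PN1 -I1 oppmx2 mulmx2.
  by congr PSLclass; apply: eqmx2.
- have ba := PSLclassM db da; have a4b := PSLclassM (dU 4%:R) db.
  rewrite -(PSLclass_unip 4) -[LHS]ba -[RHS]a4b !mulmx2.
  by congr PSLclass; apply: eqmx2.
- have cb := PSLclassM dc db.
  have dcb : \det (gen_c *m gen_b) = 1 by rewrite det_mulmx dc db mulr1.
  have cbc := PSLclassM dcb dc.
  rewrite -(PSLclass_tor 2) -[X in (X * _)%g]cb -[LHS]cbc !mulmx2.
  by congr PSLclass; apply: eqmx2.
have ca := PSLclassM dc da.
have dca : \det (gen_c *m gen_a) = 1 by rewrite det_mulmx dc da mulr1.
have cac := PSLclassM dca dc; have a6c := PSLclassM (dU 6%:R) dc.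
have dac : \det (unip 6%:R *m gen_c) = 1 by rewrite det_mulmx dc dU mulr1.
have aca := PSLclassM dac (dU 6%:R).
rewrite -(PSLclass_unip 6) -[X in (X * _ = _)%g]ca -[LHS]cac.
rewrite -[X in (_ = X * _)%g]a6c -[RHS]aca !mulmx2.
by congr PSLclass; apply: eqmx2.
Qed.

(** Closure under products suffices because the generators have finite order: the identity is c^2,
    the zeroth power of (a) is a^7, and every nonzero t is a positive power of 5. *)
Lemma PSL2F7_gen_ind (P : PSL2F7 -> Prop) :
    P (PSLclass gen_a) -> P (PSLclass gen_b) -> P (PSLclass gen_c) ->
    (forall x y, P x -> P y -> P (x * y)%g) ->
  forall x, P x.
Proof.
move=> Pa Pb Pc PM x; have [M dM ->] := PSLclass_surj x.
have [a7 _ c2 _] := PSLclass_relations.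
have PX y i : P y -> P (y ^+ i.+1)%g.
  by move=> Py; elim: i => [|i IHi] //; rewrite expgS; apply: PM.
have [da db dc] := det_gens.
elim/SL2_ind: M / dM => [|M y dM PN|M t t0 dM PN|M dM PN].
- by rewrite PSLclass1 -c2; apply: PM.
- have dU : \det (unip y) = 1 by rewrite det_mx_of_rows2; ring.
  rewrite (PSLclassM dM dU); apply: PM PN _.
  elim/F7_ind: y {dU} => [] [|i] _; rewrite PSLclass_unip; last exact: PX.
  by rewrite -[(_ ^+ 0)%g]a7; apply: PX.
- have dT : \det (tor t t^-1) = 1 by rewrite det_mx_of_rows2; field.
  rewrite (PSLclassM dM dT); apply: PM PN _ => {dT}.
  have [i ->] : exists i, t = 5 ^+ i.+1.
    elim/F7_ind: t t0 => [] [|[|[|[|[|[|[|//]]]]]]] _ // _.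
    - by exists 5%N; apply/eqP.
    - by exists 3%N; apply/eqP.
    - by exists 4%N; apply/eqP.
    - by exists 1%N; apply/eqP.
    - by exists 0%N; apply/eqP.
    - by exists 2%N; apply/eqP.
  have -> : (5 ^+ i.+1)^-1 = 3 ^+ i.+1 :> 'F_7.
    by rewrite -exprVn; congr (_ ^+ _); apply/eqP.
  by rewrite PSLclass_tor; apply: PX.
by rewrite (PSLclassM dM dc); apply: PM PN Pc.
Qed.

End PSL2F7Generators.

(** * Matrix identities *)

Section MxClass.
Variables (n : nat) (k : fieldType).
Implicit Types M N : 'M[k]_n.

Lemma mxclassE M (uM : M \in unitmx) : mxclass M = GLclass (MkGL uM).
Proof. exact: (mxclass_GL (MkGL uM)). Qed.

Lemma mxclassM M N : M \in unitmx -> N \in unitmx ->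
  mxclass (M *m N) = (mxclass M * mxclass N)%g.
Proof.
move=> uM uN; have uMN : M *m N \in unitmx by rewrite unitmx_mul uM.
rewrite !mxclassE -GLclassM; congr GLclass; exact: val_inj.
Qed.

Lemma mxclass1 : mxclass (1%:M : 'M[k]_n) = 1%g.
Proof. by rewrite (mxclassE (unitmx1 _ _)); congr GLclass; apply: val_inj. Qed.

Lemma mxclassP M N : M \in unitmx -> N \in unitmx ->
  mxclass M = mxclass N <-> exists2 c, c != 0 & N = c *: M.
Proof. by move=> uM uN; rewrite !mxclassE; apply: GLclassE. Qed.

Lemma mxclassZ c M : c != 0 -> M \in unitmx -> mxclass (c *: M) = mxclass M.
Proof.
move=> c0 uM; apply/esym/mxclassP => //; last by exists c.
by rewrite unitmxZ ?unitfE.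
Qed.

Lemma mxclass_surj (x : PGL n k) : exists2 M, M \in unitmx & x = mxclass M.
Proof.
exists (generic_quotient.repr x : 'M_n); first exact: GL_unitP.
by rewrite mxclass_GL GLclass_repr.
Qed.

Lemma kappa_mxclass M : M \in unitmx -> kappa (mxclass M) = mxclass (invmx M^T).
Proof.
move=> uM; have uMV : invmx M^T \in unitmx by rewrite unitmx_inv unitmx_tr.
by rewrite !mxclassE kappaE; congr GLclass; apply: val_inj.
Qed.

End MxClass.

Lemma mxclassX n (k : fieldType) (M : 'M[k]_n.+1) i : M \in unitmx ->
  mxclass (M ^+ i) = (mxclass M ^+ i)%g.
Proof.
move=> uM; elim: i => [|i IHi]; first exact: mxclass1.
by rewrite exprS expgS -IHi mxclassM // -[_ \in _]/(_ \is a GRing.unit) unitrX.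
Qed.

Notation mx4 a1 a2 a3 a4 b1 b2 b3 b4 c1 c2 c3 c4 d1 d2 d3 d4 :=
  (mx_of_rows 4 4 [:: [:: a1; a2; a3; a4]; [:: b1; b2; b3; b4];
                      [:: c1; c2; c3; c4]; [:: d1; d2; d3; d4]]).

Lemma mx4E (R : nzRingType) (M : 'M[R]_4) :
  let i0 := Ordinal (isT : 0 < 4)%N in let i1 := Ordinal (isT : 1 < 4)%N in
  let i2 := Ordinal (isT : 2 < 4)%N in let i3 := Ordinal (isT : 3 < 4)%N in
  M = mx4 (M i0 i0) (M i0 i1) (M i0 i2) (M i0 i3)
          (M i1 i0) (M i1 i1) (M i1 i2) (M i1 i3)
          (M i2 i0) (M i2 i1) (M i2 i2) (M i2 i3)
          (M i3 i0) (M i3 i1) (M i3 i2) (M i3 i3).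
Proof.
by apply/matrixP => -[[|[|[|[|//]]]] ?] -[[|[|[|[|//]]]] ?]; rewrite !mxE /=;
   congr (M _ _); apply: val_inj.
Qed.

Section Mx4.
Variable R : comNzRingType.
Implicit Types a b c d : R.

Lemma mx4_eq a1 a2 a3 a4 b1 b2 b3 b4 c1 c2 c3 c4 d1 d2 d3 d4
             a1' a2' a3' a4' b1' b2' b3' b4' c1' c2' c3' c4' d1' d2' d3' d4' :
  mx4 a1 a2 a3 a4 b1 b2 b3 b4 c1 c2 c3 c4 d1 d2 d3 d4 =
  mx4 a1' a2' a3' a4' b1' b2' b3' b4' c1' c2' c3' c4' d1' d2' d3' d4' :> 'M[R]_4
  <-> [/\ [/\ a1 = a1', a2 = a2', a3 = a3' & a4 = a4'],
          [/\ b1 = b1', b2 = b2', b3 = b3' & b4 = b4'],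
          [/\ c1 = c1', c2 = c2', c3 = c3' & c4 = c4']
        & [/\ d1 = d1', d2 = d2', d3 = d3' & d4 = d4']].
Proof.
split; last by case=> [[-> -> -> ->] [-> -> -> ->] [-> -> -> ->] [-> -> -> ->]].
move/matrixP => E; pose i j (jlt : (j < 4)%N) := Ordinal jlt.
have e0 : (0 < 4)%N by []. have e1 : (1 < 4)%N by [].
have e2 : (2 < 4)%N by []. have e3 : (3 < 4)%N by [].
split; split; [
  have := E (i _ e0) (i _ e0) | have := E (i _ e0) (i _ e1)
| have := E (i _ e0) (i _ e2) | have := E (i _ e0) (i _ e3)
| have := E (i _ e1) (i _ e0) | have := E (i _ e1) (i _ e1)
| have := E (i _ e1) (i _ e2) | have := E (i _ e1) (i _ e3)
| have := E (i _ e2) (i _ e0) | have := E (i _ e2) (i _ e1)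
| have := E (i _ e2) (i _ e2) | have := E (i _ e2) (i _ e3)
| have := E (i _ e3) (i _ e0) | have := E (i _ e3) (i _ e1)
| have := E (i _ e3) (i _ e2) | have := E (i _ e3) (i _ e3)]; by rewrite !mxE.
Qed.

Lemma mulmx4 a1 a2 a3 a4 b1 b2 b3 b4 c1 c2 c3 c4 d1 d2 d3 d4
             a1' a2' a3' a4' b1' b2' b3' b4' c1' c2' c3' c4' d1' d2' d3' d4' :
  mx4 a1 a2 a3 a4 b1 b2 b3 b4 c1 c2 c3 c4 d1 d2 d3 d4 *m
  mx4 a1' a2' a3' a4' b1' b2' b3' b4' c1' c2' c3' c4' d1' d2' d3' d4' =
  mx4 (a1 * a1' + a2 * b1' + a3 * c1' + a4 * d1')
      (a1 * a2' + a2 * b2' + a3 * c2' + a4 * d2')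
      (a1 * a3' + a2 * b3' + a3 * c3' + a4 * d3')
      (a1 * a4' + a2 * b4' + a3 * c4' + a4 * d4')
      (b1 * a1' + b2 * b1' + b3 * c1' + b4 * d1')
      (b1 * a2' + b2 * b2' + b3 * c2' + b4 * d2')
      (b1 * a3' + b2 * b3' + b3 * c3' + b4 * d3')
      (b1 * a4' + b2 * b4' + b3 * c4' + b4 * d4')
      (c1 * a1' + c2 * b1' + c3 * c1' + c4 * d1')
      (c1 * a2' + c2 * b2' + c3 * c2' + c4 * d2')
      (c1 * a3' + c2 * b3' + c3 * c3' + c4 * d3')
      (c1 * a4' + c2 * b4' + c3 * c4' + c4 * d4')
      (d1 * a1' + d2 * b1' + d3 * c1' + d4 * d1')
      (d1 * a2' + d2 * b2' + d3 * c2' + d4 * d2')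
      (d1 * a3' + d2 * b3' + d3 * c3' + d4 * d3')
      (d1 * a4' + d2 * b4' + d3 * c4' + d4 * d4') :> 'M[R]_4.
Proof.
by apply/matrixP => -[[|[|[|[|//]]]] ?] -[[|[|[|[|//]]]] ?];
   rewrite !mxE !big_ord_recl big_ord0 !mxE /= addr0 !addrA.
Qed.

Lemma scalemx4 x a1 a2 a3 a4 b1 b2 b3 b4 c1 c2 c3 c4 d1 d2 d3 d4 :
  x *: mx4 a1 a2 a3 a4 b1 b2 b3 b4 c1 c2 c3 c4 d1 d2 d3 d4 =
  mx4 (x * a1) (x * a2) (x * a3) (x * a4) (x * b1) (x * b2) (x * b3) (x * b4)
      (x * c1) (x * c2) (x * c3) (x * c4) (x * d1) (x * d2) (x * d3) (x * d4)
    :> 'M[R]_4.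
Proof.
by apply/matrixP => -[[|[|[|[|//]]]] ?] -[[|[|[|[|//]]]] ?]; rewrite !mxE.
Qed.

Lemma scalar_mx4 x : x%:M = mx4 x 0 0 0 0 x 0 0 0 0 x 0 0 0 0 x :> 'M[R]_4.
Proof.
by apply/matrixP => -[[|[|[|[|//]]]] ?] -[[|[|[|[|//]]]] ?]; rewrite !mxE.
Qed.

End Mx4.

Section MatrixRelations.
Variable k : fieldType.
Implicit Types e t u a b c d x y : k.

(** The matrices [G] with [B G B = G]. *)
Definition mxG t u a b c d : 'M[k]_4 := mx4 a b c t b c a t c a b t u u u d.

Lemma mxAM x y : mxA x *m mxA y = mxA (x * y).
Proof. by rewrite mulmx4; apply/mx4_eq; do 2?split; ring. Qed.

Lemma mxA1 : mxA 1 = 1%:M :> 'M[k]_4.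
Proof. by rewrite scalar_mx4 /mxA !expr1n. Qed.

Lemma mxclass_mxAX e i : e != 0 ->
  (mxclass (mxA e) ^+ i)%g = mxclass (mxA (e ^+ i)).
Proof.
move=> e0; elim: i => [|i IHi]; first by rewrite expr0 mxA1 mxclass1.
by rewrite expgS IHi -mxclassM ?mxA_unit ?expf_neq0 // mxAM exprS.
Qed.

Lemma mxB_sqr : mxB *m mxB = mx4 0 0 1 0 1 0 0 0 0 1 0 0 0 0 0 1 :> 'M[k]_4.
Proof. by rewrite mulmx4; apply/mx4_eq; do 2?split; ring. Qed.

Lemma mxB_cube : mxB *m (mxB *m mxB) = 1%:M :> 'M[k]_4.
Proof. by rewrite mxB_sqr mulmx4 scalar_mx4; apply/mx4_eq; do 2?split; ring. Qed.

Lemma mxB_A e : e ^+ 7 = 1 -> mxB *m mxA e = mxA (e ^+ 4) *m mxB.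
Proof. by move=> e7; rewrite !mulmx4; apply/mx4_eq; do 2?split; ring: e7. Qed.

Lemma mxB_G_B t u a b c d : mxB *m mxG t u a b c d *m mxB = mxG t u a b c d.
Proof. by rewrite !mulmx4; apply/mx4_eq; do 2?split; ring. Qed.

Lemma mxG_sqrP t u a b c d D :
  mxG t u a b c d *m mxG t u a b c d = D%:M <->
  [/\ a ^+ 2 + b ^+ 2 + c ^+ 2 + t * u = D, a * b + b * c + c * a + t * u = 0,
      t * (a + b + c + d) = 0, u * (a + b + c + d) = 0 & 3 * (t * u) + d ^+ 2 = D].
Proof.
rewrite mulmx4 scalar_mx4 mx4_eq; split.
  case=> [[E11 E12 _ E14] _ _ [E41 _ _ E44]].
  by split; [apply: etrans E11 | apply: etrans E12 | apply: etrans E14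
            | apply: etrans E41 | apply: etrans E44]; ring.
case=> E1 E2 E3 E4 E5; split; split;
  by [ apply: etrans E1; ring | apply: etrans E2; ring | apply: etrans E3; ring
     | apply: etrans E4; ring | apply: etrans E5; ring].
Qed.

(** Thirteen equations stand for sixteen entries, since the upper left 3 by 3 blocks of both sides
    are symmetric. *)
Lemma mxG_A_GP e t u a b c d m : e ^+ 7 = 1 ->
  mxG t u a b c d *m mxA e *m mxG t u a b c d =
    m *: (mxA (e ^+ 6) *m mxG t u a b c d *m mxA (e ^+ 6)) <->
  [/\ [/\ e ^+ 4 * a ^+ 2 + e ^+ 2 * b ^+ 2 + e * c ^+ 2 + t * u = m * (e ^+ 6 * a),
          e ^+ 4 * (a * b) + e ^+ 2 * (b * c) + e * (c * a) + t * u = m * (e * b),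
          e ^+ 4 * (c * a) + e ^+ 2 * (a * b) + e * (b * c) + t * u = m * (e ^+ 2 * c)
        & t * (e ^+ 4 * a + e ^+ 2 * b + e * c + d) = m * (e ^+ 3 * t)],
      [/\ e ^+ 4 * b ^+ 2 + e ^+ 2 * c ^+ 2 + e * a ^+ 2 + t * u = m * (e ^+ 3 * c),
          e ^+ 4 * (b * c) + e ^+ 2 * (c * a) + e * (a * b) + t * u = m * (e ^+ 4 * a)
        & t * (e ^+ 4 * b + e ^+ 2 * c + e * a + d) = m * (e ^+ 5 * t)],
      e ^+ 4 * c ^+ 2 + e ^+ 2 * a ^+ 2 + e * b ^+ 2 + t * u = m * (e ^+ 5 * b),
      t * (e ^+ 4 * c + e ^+ 2 * a + e * b + d) = m * (e ^+ 6 * t)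
    & [/\ u * (e ^+ 4 * a + e ^+ 2 * b + e * c + d) = m * (e ^+ 3 * u),
          u * (e ^+ 4 * b + e ^+ 2 * c + e * a + d) = m * (e ^+ 5 * u),
          u * (e ^+ 4 * c + e ^+ 2 * a + e * b + d) = m * (e ^+ 6 * u)
        & (e ^+ 4 + e ^+ 2 + e) * (t * u) + d ^+ 2 = m * d]].
Proof.
move=> e7; rewrite !mulmx4 scalemx4 mx4_eq; split.
  case=> [[E11 E12 E13 E14] [_ E22 E23 E24] [_ _ E33 E34] [E41 E42 E43 E44]].
  split; [split | split | | | split];
    [ apply: etrans (etrans E11 _) | apply: etrans (etrans E12 _)
    | apply: etrans (etrans E13 _) | apply: etrans (etrans E14 _)
    | apply: etrans (etrans E22 _) | apply: etrans (etrans E23 _)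
    | apply: etrans (etrans E24 _) | apply: etrans (etrans E33 _)
    | apply: etrans (etrans E34 _) | apply: etrans (etrans E41 _)
    | apply: etrans (etrans E42 _) | apply: etrans (etrans E43 _)
    | apply: etrans (etrans E44 _) ]; ring: e7.
case=> [[E11 E12 E13 E14] [E22 E23 E24] E33 E34 [E41 E42 E43 E44]].
split; split;
  [ apply: etrans (etrans E11 _) | apply: etrans (etrans E12 _)
  | apply: etrans (etrans E13 _) | apply: etrans (etrans E14 _)
  | apply: etrans (etrans E12 _) | apply: etrans (etrans E22 _)
  | apply: etrans (etrans E23 _) | apply: etrans (etrans E24 _)
  | apply: etrans (etrans E13 _) | apply: etrans (etrans E23 _)
  | apply: etrans (etrans E33 _) | apply: etrans (etrans E34 _)
  | apply: etrans (etrans E41 _) | apply: etrans (etrans E42 _)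
  | apply: etrans (etrans E43 _) | apply: etrans (etrans E44 _) ]; ring: e7.
Qed.

Lemma mxclass_relations e G D m : e ^+ 7 = 1 -> G \in unitmx ->
    mxB *m G *m mxB = G -> G *m G = D%:M ->
    G *m mxA e *m G = m *: (mxA (e ^+ 6) *m G *m mxA (e ^+ 6)) ->
  PSL2F7_relations (mxclass (mxA e)) (mxclass mxB) (mxclass G).
Proof.
move=> e7 uG BGB GG GAG.
have e0 : e != 0.
  by apply: contra_eq_neq e7 => ->; rewrite expr0n eq_sym oner_eq0.
have uA i : mxA (e ^+ i) \in unitmx by rewrite mxA_unit ?expf_neq0.
have uA1 : mxA e \in unitmx by rewrite mxA_unit.
have unit_neq0 x (M : 'M[k]_4) : x *: M \in unitmx -> x != 0 :> k.
  apply: contraL => /eqP->.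
  by rewrite scale0r unitmxE det0 unitr0.
have m0 : m != 0.
  apply: (unit_neq0 _ (mxA (e ^+ 6) *m G *m mxA (e ^+ 6))).
  by rewrite -GAG !unitmx_mul uG uA1.
have D0 : D != 0 by apply: (unit_neq0 D 1%:M); rewrite scalemx1 -GG unitmx_mul uG.
have B3 : (mxclass (mxB : 'M[k]_4) ^+ 3 = 1)%g.
  by rewrite 2!expgS expg1 -!mxclassM ?unitmx_mul ?mxB_unit // mxB_cube mxclass1.
have C2 : (mxclass G * mxclass G = 1)%g.
  by rewrite -mxclassM // GG -scalemx1 mxclassZ ?unitmx1 // mxclass1.
split=> //; first by rewrite mxclass_mxAX // e7 mxA1 mxclass1.
split; rewrite ?mxclass_mxAX //.
- by rewrite -!mxclassM ?mxB_unit // mxB_A.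
(* As the class of [G] is an involution, bcb = c gives b (cbc) = 1 = b^3, whence cbc = b^2. *)
- have bcb : (mxclass mxB * mxclass G * mxclass mxB = mxclass G)%g.
    by rewrite -!mxclassM ?unitmx_mul ?uG ?mxB_unit // BGB.
  by apply: (mulgI (mxclass mxB)); rewrite !mulgA bcb C2 -[LHS]B3 2!expgS expg1 mulgA.
by rewrite -!mxclassM ?unitmx_mul ?uG ?uA ?uA1 // GAG mxclassZ ?unitmx_mul ?uA ?uG.
Qed.

End MatrixRelations.

(** * The relations for the explicit matrices *)

Section SeventhRoots.
Variable k : fieldType.
Hypothesis char_k : [pchar k] =i pred0.
Implicit Types s t u a b c d x y : k.

Let natr_neq0 n : n.+1%:R != 0 :> k.
Proof. by rewrite ((pcharf0P k).1 char_k). Qed.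

Section Root.
Variable e : k.
Hypothesis prim_e : 7.-primitive_root e.

(** As a rewriting rule for [ring] and [field], this reduces powers of e to the basis 1, e, ..., e^5
    of the cyclotomic field. *)
Lemma prim7_expr6 : e ^+ 6 = - (1 + e + e ^+ 2 + e ^+ 3 + e ^+ 4 + e ^+ 5).
Proof. by apply/eqP; rewrite -addr_eq0 addrC Phi7_root. Qed.
Let e6 := prim7_expr6.

Let e7 : e ^+ 7 = 1. Proof. exact: prim_expr_order. Qed.

Lemma prim7_neq0 : e != 0.
Proof. by apply: contra_eq_neq e7 => ->; rewrite expr0n eq_sym oner_eq0. Qed.

(** The bottom right entries force the scalars: D = 3 t u + 1 and m = eta t u + 1, with t u = s^2 =
    2. *)
Lemma relations_sqrt2 s : s ^+ 2 = 2 ->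
  PSL2F7_relations (mxclass (mxA e)) (mxclass mxB) (mxclass (mxC_sqrt2 s e)).
Proof.
move=> s2; apply: (mxclass_relations (D := 7)
  (m := 2 * (e + e ^+ 2 + e ^+ 4) + 1)) => //.
- exact: mxC_sqrt2_unit.
- exact: mxB_G_B.
- by apply/mxG_sqrP; split; ring: e6 s2.
- by apply/(mxG_A_GP _ _ _ _ _ _ _ e7); split; [split|split| | |split]; ring: e6 s2.
Qed.

Lemma relations_0 :
  PSL2F7_relations (mxclass (mxA e)) (mxclass mxB) (mxclass (mxC_0 e)).
Proof.
apply: (mxclass_relations (D := 1) (m := 1)) => //.
- exact: mxC_0_unit.
- exact: mxB_G_B.
- by apply/mxG_sqrP; split; field: e6.
- by apply/(mxG_A_GP _ _ _ _ _ _ _ e7); split; [split|split| | |split];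
     field: e6.
Qed.

Lemma mxclass_mxA_neq1 : mxclass (mxA e) != 1%g.
Proof.
apply/negP => /eqP; rewrite -mxclass1.
case/(mxclassP (mxA_unit prim7_neq0) (unitmx1 _ _)) => x _.
rewrite scalar_mx4 scalemx4 => /mx4_eq[_ _ [_ _ E3 _] [_ _ _ E4]].
move: E3; rewrite -[x]mulr1 -E4 mul1r => /esym/eqP.
by rewrite -[e]expr1 -(prim_order_dvd prim_e).
Qed.

End Root.
End SeventhRoots.

(** * Classification of the lifts *)

(** Certificate for solving a linear system: p, q, r are the multipliers of three known equations.
    The integer N clears denominators, so the identity to check has integral coefficients in e. *)
Lemma linear_combination3 (F : idomainType) (N x y p q r l1 r1 l2 r2 l3 r3 : F) :
    N != 0 -> l1 = r1 -> l2 = r2 -> l3 = r3 ->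
    N * (x - y) = p * (l1 - r1) + q * (l2 - r2) + r * (l3 - r3) ->
  x = y.
Proof.
move=> N0 -> -> ->; rewrite !subrr !mulr0 !addr0 => /eqP.
by rewrite mulf_eq0 (negPf N0) subr_eq0 => /eqP.
Qed.

Section Solve.
Variable k : fieldType.
Hypothesis char_k : [pchar k] =i pred0.

Let natr_neq0 n : n.+1%:R != 0 :> k.
Proof. by rewrite ((pcharf0P k).1 char_k). Qed.

Variable e : k.
Hypothesis prim_e : 7.-primitive_root e.
Let e6 := prim7_expr6 prim_e.
Let e7 : e ^+ 7 = 1. Proof. exact: prim_expr_order. Qed.

Variables (t u a b c D m : k).
Hypothesis GG : mxG t u a b c 1 *m mxG t u a b c 1 = D%:M.
Hypothesis GAG : mxG t u a b c 1 *m mxA e *m mxG t u a b c 1 =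
  m *: (mxA (e ^+ 6) *m mxG t u a b c 1 *m mxA (e ^+ 6)).

(** With [eta = e + e^2 + e^4] and [etab = e^3 + e^5 + e^6], one has
    [eta + etab = -1] and [eta * etab = 2]; adding the three last-column (or last-row)
    equations gives [3 - eta = (1 + eta * t * u) * etab]. *)
Lemma mxG_tu : t != 0 \/ u != 0 -> t * u = 2.
Proof.
have /mxG_sqrP[_ _ S3 S4 _] := GG.
have /(mxG_A_GP _ _ _ _ _ _ _ e7)[[_ _ _ E14] [_ _ E24] _ E34 [E41 E42 E43 E44]] := GAG.
have sum x : x != 0 -> x * (a + b + c + 1) = 0 ->
    x * (e ^+ 4 * a + e ^+ 2 * b + e * c + 1) = m * (e ^+ 3 * x) ->
    x * (e ^+ 4 * b + e ^+ 2 * c + e * a + 1) = m * (e ^+ 5 * x) ->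
    x * (e ^+ 4 * c + e ^+ 2 * a + e * b + 1) = m * (e ^+ 6 * x) -> t * u = 2.
  move=> x0 F1 F2 F3 F4; have F5 : m = (e ^+ 4 + e ^+ 2 + e) * (t * u) + 1.
    by rewrite -[LHS]mulr1 -E44 expr1n.
  have F : x * ((e ^+ 4 + e ^+ 2 + e) * (a + b + c) + 3) =
           ((e ^+ 4 + e ^+ 2 + e) * (t * u) + 1) * ((e ^+ 3 + e ^+ 5 + e ^+ 6) * x).
    by rewrite -F5 !mulrDl !mulrDr -F2 -F3 -F4; ring.
  apply: (mulfI (mulf_neq0 (natr_neq0 1) x0)).
  apply: (linear_combination3 (N := 1) (p := e ^+ 4 + e ^+ 2 + e) (q := -1) (r := 0)
    _ F1 F (erefl 0)); first exact: oner_neq0.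
  by ring: e6.
by case=> x0; [apply: (sum t) | apply: (sum u)].
Qed.

(** Since t can be cancelled and m is known, the last columns of [GG] and [GAG] give equations
    linear in a, b, c. The multipliers are the rows of 7 times the inverse of the matrix of the
    system [F1], [F2], [F3]. *)
Lemma solve_sqrt2 : t * u = 2 ->
  [/\ a = e + e ^+ 6, b = e ^+ 2 + e ^+ 5 & c = e ^+ 3 + e ^+ 4].
Proof.
move=> tu; have t0 : t != 0.
  by apply: contra_eq_neq tu => ->; rewrite mul0r eq_sym.
have /mxG_sqrP[_ _ S3 _ _] := GG.
have /(mxG_A_GP _ _ _ _ _ _ _ e7)[[_ _ _ E14] [_ _ E24] _ _ [_ _ _ E44]] := GAG.
have mE : m = 2 * (e + e ^+ 2 + e ^+ 4) + 1.
  by rewrite -[LHS]mulr1 -E44 tu expr1n; ring.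
have F1 : e ^+ 4 * a + e ^+ 2 * b + e * c + 1 = m * e ^+ 3.
  by apply: (mulfI t0); rewrite E14; ring.
have F2 : e ^+ 4 * b + e ^+ 2 * c + e * a + 1 = m * e ^+ 5.
  by apply: (mulfI t0); rewrite E24; ring.
have F3 : a + b + c + 1 = 0.
  by apply: (mulfI t0); rewrite S3 mulr0.
rewrite mE in F1 F2.
split.
- apply: (linear_combination3 (N := 7)
      (p := - 2 * e + e ^+ 2 + 2 * e ^+ 3 + e ^+ 4 - 2 * e ^+ 5)
      (q := - 2 - 3 * e - 3 * e ^+ 2 - 2 * e ^+ 3 - 4 * e ^+ 5)
      (r := 2 - 2 * e + 2 * e ^+ 2 - e ^+ 4 - e ^+ 5) _ F1 F2 F3) => //.
  by ring: e6.
- apply: (linear_combination3 (N := 7)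
      (p := 2 + 3 * e + 3 * e ^+ 2 + 2 * e ^+ 3 + 4 * e ^+ 5)
      (q := 2 + e + 4 * e ^+ 2 + 4 * e ^+ 3 + e ^+ 4 + 2 * e ^+ 5)
      (r := 3 + 3 * e + e ^+ 3 - e ^+ 4 + e ^+ 5) _ F1 F2 F3) => //.
  by ring: e6.
- apply: (linear_combination3 (N := 7)
      (p := - 2 - e - 4 * e ^+ 2 - 4 * e ^+ 3 - e ^+ 4 - 2 * e ^+ 5)
      (q := 2 * e - e ^+ 2 - 2 * e ^+ 3 - e ^+ 4 + 2 * e ^+ 5)
      (r := 2 - e - 2 * e ^+ 2 - e ^+ 3 + 2 * e ^+ 4) _ F1 F2 F3) => //.
  by ring: e6.
Qed.

(** The entries of [GAG] are quadratic in [a], [b], [c], but the row sums and the two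
    diagonal orbit sums become linear by [GG = 1]; the trace sign [a + b + c = 1] is
    excluded because the homogeneous system then has only the zero solution. *)
Lemma solve_0 : t = 0 -> u = 0 ->
  [/\ a = 7^-1 * (- 2 - e + 2 * e ^+ 2 + 2 * e ^+ 5 - e ^+ 6),
      b = 7^-1 * (- 2 - e ^+ 2 + 2 * e ^+ 3 + 2 * e ^+ 4 - e ^+ 5)
    & c = 7^-1 * (- 2 + 2 * e - e ^+ 3 - e ^+ 4 + 2 * e ^+ 6)].
Proof.
move=> t0 u0; have /mxG_sqrP := GG.
have /(mxG_A_GP _ _ _ _ _ _ _ e7) := GAG; rewrite t0 u0.
case=> [[E11 E12 E13 _] [E22 E23 _] E33 _ [_ _ _ E44]] [S1 S2 _ _ S5].
have m1 : m = 1 by rewrite -[LHS]mulr1 -E44; ring.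
have D1 : D = 1 by rewrite -S5; ring.
rewrite m1 !(mul1r, mulr0, addr0) in E11 E12 E13 E22 E23 E33 S1 S2.
rewrite D1 in S1.
have F1 : e ^+ 4 * a + e * b + e ^+ 2 * c = 0.
  by rewrite -E23 -E12 -E13 -(mulr0 (e ^+ 4 + e ^+ 2 + e)) -S2; ring.
have F2 : e ^+ 6 * a + e ^+ 5 * b + e ^+ 3 * c = e + e ^+ 2 + e ^+ 4.
  rewrite -E11 -E33 -E22 -[RHS]mulr1 -S1; ring.
have : (a + b + c == 1) || (a + b + c == -1).
  by rewrite -eqf_sqr; apply/eqP; rewrite expr1n -S1 -[RHS]addr0 -(mulr0 2) -S2; ring.
case/orP=> /eqP F3.
  have G1 : e ^+ 4 * a + e ^+ 2 * b + e * c = e ^+ 6 * a + e * b + e ^+ 2 * c.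
    by rewrite -E11 -E12 -E13 -[LHS]mulr1 -F3; ring.
  have G2 : e ^+ 4 * b + e ^+ 2 * c + e * a = e * b + e ^+ 3 * c + e ^+ 4 * a.
    by rewrite -E12 -E22 -E23 -[LHS]mulr1 -F3; ring.
  move/esym/eqP: G1; rewrite -subr_eq0 => /eqP G1.
  move/esym/eqP: G2; rewrite -subr_eq0 => /eqP G2.
  have /eqP : 1 = 0 :> k; last by rewrite oner_eq0.
  rewrite -F3.
  apply: (linear_combination3 (N := 14)
      (p := - 7 - 14 * e - 14 * e ^+ 2 - 14 * e ^+ 4)
      (q := - 10 - 13 * e - 2 * e ^+ 2 - 12 * e ^+ 3 - 15 * e ^+ 4 - 11 * e ^+ 5)
      (r := 5 - 11 * e - 6 * e ^+ 2 + 6 * e ^+ 3 - 3 * e ^+ 4 - 19 * e ^+ 5) _ F1 G1 G2) => //.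
  by ring: e6.
split.
- apply: (linear_combination3 (N := 14)
      (p := 1 + e + 5 * e ^+ 3 + 2 * e ^+ 4 - 2 * e ^+ 5)
      (q := 1 + 5 * e - 2 * e ^+ 2 + e ^+ 3 + 2 * e ^+ 5)
      (r := 5 + e + 2 * e ^+ 2 + e ^+ 3 - 2 * e ^+ 4) _ F1 F2 F3) => //.
  by field: e6.
- apply: (linear_combination3 (N := 14)
      (p := - 4 - 3 * e - 4 * e ^+ 2 - 7 * e ^+ 3 - 5 * e ^+ 4 - 5 * e ^+ 5)
      (q := - e + 4 * e ^+ 2 + e ^+ 3 - 3 * e ^+ 4 - e ^+ 5)
      (r := 4 - 3 * e - e ^+ 3 + e ^+ 4 - e ^+ 5) _ F1 F2 F3) => //.
  by field: e6.
- apply: (linear_combination3 (N := 14)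
      (p := 3 + 2 * e + 4 * e ^+ 2 + 2 * e ^+ 3 + 3 * e ^+ 4 + 7 * e ^+ 5)
      (q := - 1 - 4 * e - 2 * e ^+ 2 - 2 * e ^+ 3 + 3 * e ^+ 4 - e ^+ 5)
      (r := 5 + 2 * e - 2 * e ^+ 2 + e ^+ 4 + e ^+ 5) _ F1 F2 F3) => //.
  by field: e6.
Qed.

End Solve.

(** * The image of (c), given those of (a) and (b) *)

Section ThirdGenerator.
Variable k : fieldType.
Hypothesis char_k : [pchar k] =i pred0.
Variables e s : k.
Hypothesis prim_e : 7.-primitive_root e.
Hypothesis s2 : s ^+ 2 = 2.

Let natr_neq0 n : n.+1%:R != 0 :> k.
Proof. by rewrite ((pcharf0P k).1 char_k). Qed.
Let e6 := prim7_expr6 prim_e.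
Let e7 : e ^+ 7 = 1. Proof. exact: prim_expr_order. Qed.

(** The hypothesis says that [B] is conjugate under [C] to l B^2, and both [B] and [B^2] have trace
    1. *)
Lemma mxB_C_B_eq (C : 'M[k]_4) l : C \in unitmx ->
  mxB *m C *m mxB = l *: C -> mxB *m C *m mxB = C.
Proof.
move=> uC E; suff l1 : l = 1 by rewrite E l1 scale1r.
have CB : C *m mxB *m invmx C = l *: (mxB *m mxB).
  rewrite -[C *m mxB]mul1mx -mxB_cube -!mulmxA (mulmxA mxB C) (mulmxA (mxB *m C)) E.
  by rewrite -scalemxAl mulmxV // -!scalemxAr mulmx1.
have := congr1 mxtrace CB; rewrite mxtrace_mulC mulKmx // mxtraceZ mxB_sqr.
by rewrite /mxtrace !big_ord_recl !big_ord0 !mxE /= !add0r addr0 mulr1 => ->.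
Qed.

Lemma mxG_of_fixed (C : 'M[k]_4) : mxB *m C *m mxB = C ->
  exists t u a b c d, C = mxG t u a b c d.
Proof.
rewrite (mx4E C) /=.
move: (C _ _) => c00; move: (C _ _) => c01; move: (C _ _) => c02; move: (C _ _) => c03.
move: (C _ _) => c10; move: (C _ _) => c11; move: (C _ _) => c12; move: (C _ _) => c13.
move: (C _ _) => c20; move: (C _ _) => c21; move: (C _ _) => c22; move: (C _ _) => c23.
move: (C _ _) => c30; move: (C _ _) => c31; move: (C _ _) => c32; move: (C _ _) => c33.
rewrite !mulmx4 mx4_eq !(mul0r, mul1r, mulr0, mulr1, add0r, addr0).
case=> [[E1 E2 E3 E4] [E5 E6 E7 E8] [E9 E10 E11 E12] [E13 E14 E15 _]].
by exists c03, c30, c00, c01, c02, c33; apply/mx4_eq; split; split; congruence.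
Qed.

Lemma mxC_classification (C : 'M[k]_4) l D m : C \in unitmx ->
    mxB *m C *m mxB = l *: C -> C *m C = D%:M ->
    C *m mxA e *m C = m *: (mxA (e ^+ 6) *m C *m mxA (e ^+ 6)) ->
  exists P, [/\ P \in unitmx, P *m mxA e = mxA e *m P, P *m mxB = mxB *m P &
    exists2 x, x != 0 & P *m C = x *: (mxC_0 e *m P) \/
                        P *m C = x *: (mxC_sqrt2 s e *m P)].
Proof.
move=> uC /(mxB_C_B_eq uC)/mxG_of_fixed[t [u [a [b [c [d CE]]]]]].
rewrite {}CE in uC *.
move=> GG GAG.
(* If d = 0, the bottom right entries give eta t u = 0 and D = 3 t u. As eta etab = 2, t u vanishes,
   so D = 0 and the square of an invertible matrix would be 0. Hence d can be scaled to 1. *)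
have d0 : d != 0.
  have /mxG_sqrP[_ _ _ _ S5] := GG.
  have /(mxG_A_GP _ _ _ _ _ _ _ e7)[_ _ _ _ [_ _ _ E44]] := GAG.
  apply: contraTneq uC => d0; rewrite d0 in S5 E44.
  have D0 : D = 0.
    apply: (mulfI (natr_neq0 1)).
    apply: (linear_combination3 (N := 1) (p := 3 * (e ^+ 3 + e ^+ 5 + e ^+ 6))
      (q := -2) (r := 0) _ E44 S5 (erefl 0)); first exact: oner_neq0.
    by ring: e6.
  apply/negP => uC; have : mxG t u a b c d *m mxG t u a b c d \in unitmx.
    by rewrite unitmx_mul uC.
  by rewrite GG D0 -scalemx1 scale0r unitmxE det0 unitr0.
pose G := mxG (t / d) (u / d) (a / d) (b / d) (c / d) 1.
have GE : mxG t u a b c d = d *: G.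
  by rewrite scalemx4; apply/mx4_eq; do 2?split; field.
have GG1 : G *m G = (D / d ^+ 2)%:M.
  apply: (scalerI (expf_neq0 2 d0)); rewrite scale_scalar_mx mulrCA divff ?mulr1 ?expf_neq0 //.
  by rewrite -GG GE -scalemxAl -scalemxAr scalerA.
have GAG1 : G *m mxA e *m G = (m / d) *: (mxA (e ^+ 6) *m G *m mxA (e ^+ 6)).
  move: GAG; rewrite GE -!scalemxAl -!scalemxAr -!scalemxAl !scalerA => E.
  apply: (scalerI (expf_neq0 2 d0)); rewrite expr2 E scalerA; congr (_ *: _).
  by field.
have [t0u0 | tu0] : (t / d = 0 /\ u / d = 0) \/ (t / d != 0 \/ u / d != 0).
- by case: eqVneq => t0; case: eqVneq => u0; [left | right | right | right]; auto.
- have [t0 u0] := t0u0; have [Ea Eb Ec] := solve_0 char_k prim_e GG1 GAG1 t0 u0.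
  exists 1%:M; split; rewrite ?unitmx1 ?mul1mx ?mulmx1 //.
  exists d => //; left.
  by rewrite GE /G t0 u0 Ea Eb Ec.
have tu : t / d * (u / d) = 2 := mxG_tu char_k prim_e GG1 GAG1 tu0.
have [Ea Eb Ec] := solve_sqrt2 char_k prim_e GG1 GAG1 tu.
have t0 : t / d != 0 by apply: contra_eq_neq tu => ->; rewrite mul0r eq_sym.
have s0 : s != 0 by apply: contra_eq_neq s2 => ->; rewrite expr0n eq_sym.
move: GE; rewrite /G Ea Eb Ec; move: (t / d) (u / d) tu t0 => t1 u1 tu t0 GE.
(* These diagonal matrices commute with [mxA e] and [mxB]. Conjugation by [P x] multiplies t by x
   and divides u by x; x = s / t1 takes t1 to s, and then u1 to s as well because t1 u1 = 2 =
   s^2. *)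
pose P x : 'M[k]_4 := mx4 x 0 0 0 0 x 0 0 0 0 x 0 0 0 0 1.
exists (P (s / t1)); split.
- suff /mulmx1_unit[] : P (s / t1) *m P (t1 / s) = 1%:M by [].
  by rewrite mulmx4 scalar_mx4; apply/mx4_eq; do 2?split; field; rewrite ?s0 ?t0.
- by rewrite !mulmx4; apply/mx4_eq; do 2?split; ring.
- by rewrite !mulmx4; apply/mx4_eq; do 2?split; ring.
exists d => //; right; rewrite GE -scalemxAr; congr (_ *: _).
have u1E : u1 = s * (s / t1) by apply: (mulfI t0); rewrite tu -s2; field.
by rewrite u1E !mulmx4; apply/mx4_eq; split; split; field.
Qed.

End ThirdGenerator.

(** Eigenvectors for distinct eigenvalues are independent: applying all factors M - d j with j
    different from i to a relation between the rows leaves only its i-th term, with a nonzero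
    coefficient. *)
Lemma eigenrows_unit n (F : fieldType) (M P : 'M[F]_n) (d : 'I_n -> F) :
    injective d -> (forall i, row i P *m M = d i *: row i P) ->
    (forall i, row i P != 0) ->
  P \in unitmx.
Proof.
move=> injd PM P0; rewrite unitmxE unitfE; apply/negP => /det0P[x /rV0Pn[i xi] xP].
have kill (s : seq 'I_n) :
    \sum_i (x 0 i * \prod_(j <- s) (d i - d j)) *: row i P = 0.
  elim: s => [|j s IHs].
    by rewrite -[RHS]xP mulmx_sum_row; apply: eq_bigr => l _; rewrite big_nil mulr1.
  have := congr1 (mulmx^~ (M - (d j)%:M)) IHs; rewrite mul0mx => {2}<-.
  rewrite mulmx_suml; apply: eq_bigr => l _.
  rewrite big_cons -scalemxAl mulmxBr PM mul_mx_scalar -scalerBl scalerA.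
  by congr (_ *: _); ring.
pose s := [seq j <- enum 'I_n | j != i].
have rest l : l != i -> (x 0 l * \prod_(j <- s) (d l - d j)) *: row l P = 0.
  move=> li; suff -> : \prod_(j <- s) (d l - d j) = 0 by rewrite mulr0 scale0r.
  apply/eqP; rewrite prodf_seq_eq0; apply/hasP; exists l; last by rewrite /= subrr.
  by rewrite mem_filter li mem_enum.
have := kill s; rewrite (bigD1 i) //= [X in _ + X]big1 // addr0 => /eqP.
rewrite scaler_eq0 (negPf (P0 i)) orbF mulf_eq0 (negPf xi) /=.
rewrite prodf_seq_eq0 => /hasP[j]; rewrite mem_filter => /andP[ji _] /=.
by rewrite subr_eq0 (inj_eq injd) eq_sym (negPf ji).
Qed.

(** * The images of (a) and (b) *)

Section FirstGenerators.
Variable k : closedFieldType.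
Variable eps : k.
Hypothesis prim_eps : 7.-primitive_root eps.

(** X^7 - 1 splits over the powers of [eps]. If M - eps^i were invertible for every i from 1 to 6,
    the remaining factor M - 1 would be 0. *)
Lemma eigenvalue_of_order7 n (M : 'M[k]_n.+1) : M ^+ 7 = 1 -> M != 1 ->
  exists2 z, 7.-primitive_root z & eigenvalue M z.
Proof.
move=> M7 M1; have prod0 : \prod_(0 <= i < 7) (M - (eps ^+ i)%:M) = 0.
  have := congr1 (horner_mx M) (factor_Xn_sub_1 prim_eps).
  rewrite rmorph_prod rmorphB rmorphXn rmorph1 /= horner_mx_X M7 subrr => <-.
  by apply: eq_bigr => i _; rewrite rmorphB /= horner_mx_X horner_mx_C.
have [/hasP[i] | /hasPn H] := boolP (has (fun i => eigenvalue M (eps ^+ i)) (index_iota 1 7)).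
  rewrite mem_index_iota => /andP[i1 i7] ev; exists (eps ^+ i) => //.
  rewrite prim_root_exp_coprime // coprime_sym prime_coprime //.
  by rewrite gtnNdvd.
case/eqP: M1; apply/eqP; rewrite -subr_eq0; apply/eqP.
rewrite big_ltn // expr0 in prod0.
have uprod : \prod_(1 <= i < 7) (M - (eps ^+ i)%:M) \is a GRing.unit.
  rewrite big_seq; apply: rpred_prod => i /H.
  by rewrite /eigenvalue negbK kermx_eq0 row_free_unit.
by apply: (mulIr uprod); rewrite mul0r.
Qed.

(** Three of the four roots of the characteristic polynomial have product z^7 = 1, and so does the
    full set, so the fourth root is 1. *)
Lemma eigenvalue1 (M : 'M[k]_4) z : 7.-primitive_root z -> \det M = 1 ->
    eigenvalue M z -> eigenvalue M (z ^+ 2) -> eigenvalue M (z ^+ 4) ->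
  eigenvalue M 1.
Proof.
move=> pz dM; rewrite !eigenvalue_root_char => r1 r2 r4.
have : \prod_(x <- [:: z; z ^+ 2; z ^+ 4]) ('X - x%:P) %| char_poly M.
  apply: uniq_roots_dvdp; first by rewrite /= r1 r2 r4.
  rewrite uniq_rootsE /= !inE -[z in z == _]expr1 -[z in z == z ^+ 4]expr1.
  by rewrite !(eq_prim_root_expr pz).
case/dvdpP=> q Eq.
have monP : \prod_(x <- [:: z; z ^+ 2; z ^+ 4]) ('X - x%:P) \is monic.
  exact: monic_prod_XsubC.
have q0 : q != 0.
  apply: contraTneq (char_poly_monic M) => q0.
  by rewrite Eq q0 mul0r monicE lead_coef0 eq_sym oner_eq0.
have sq : size q = 2%N.
  have := size_char_poly M; rewrite Eq size_Mmonic // size_prod_XsubC /= addn4.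
  by case.
have lq : q`_1 = 1.
  have /monicP := char_poly_monic M; rewrite Eq lead_coef_Mmonic //.
  by rewrite lead_coefE sq.
have qE x : q.[x] = q`_0 + x.
  by rewrite horner_coef sq !big_ord_recl big_ord0 /= lq expr0; ring.
have E := char_poly_det M.
rewrite dM -horner_coef0 Eq hornerM qE !big_cons big_nil /= !hornerE /= in E.
rewrite Eq rootM; apply/orP; left; apply/rootP; rewrite qE.
have z7 := prim_expr_order pz.
have -> : q`_0 = -1 by apply: oppr_inj; rewrite opprK; apply: etrans (etrans E _); ring: z7.
by rewrite addNr.
Qed.

Definition rows4 (r0 r1 r2 r3 : 'rV[k]_4) : 'M[k]_4 :=
  \matrix_i nth 0 [:: r0; r1; r2; r3] i.

Lemma rows4_mulmx r0 r1 r2 r3 M :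
  rows4 r0 r1 r2 r3 *m M = rows4 (r0 *m M) (r1 *m M) (r2 *m M) (r3 *m M).
Proof.
by apply/row_matrixP => -[[|[|[|[|//]]]] ?]; rewrite row_mul !rowK.
Qed.

Lemma mulmx_rows4 a1 a2 a3 a4 b1 b2 b3 b4 c1 c2 c3 c4 d1 d2 d3 d4 r0 r1 r2 r3 :
  mx4 a1 a2 a3 a4 b1 b2 b3 b4 c1 c2 c3 c4 d1 d2 d3 d4 *m rows4 r0 r1 r2 r3 =
  rows4 (a1 *: r0 + a2 *: r1 + a3 *: r2 + a4 *: r3)
        (b1 *: r0 + b2 *: r1 + b3 *: r2 + b4 *: r3)
        (c1 *: r0 + c2 *: r1 + c3 *: r2 + c4 *: r3)
        (d1 *: r0 + d2 *: r1 + d3 *: r2 + d4 *: r3).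
Proof.
apply/row_matrixP => -[[|[|[|[|//]]]] ?]; rewrite row_mul mulmx_sum_row;
  by rewrite !big_ord_recl big_ord0 !rowK !mxE /= addr0 !addrA.
Qed.

(** If [z] is an eigenvalue then so are [z^2] and [z^4], hence also [1] since the
    determinant is [1]; [B] permutes the four eigenlines. *)
Lemma AB_classification_normalized (A B : 'M[k]_4) y : A \in unitmx -> B \in unitmx ->
    A ^+ 7 = 1 -> A != 1 -> B *m A = A ^+ 4 *m B -> B *m (B *m B) = y%:M ->
  exists P e x, [/\ 7.-primitive_root e, P \in unitmx,
    P *m A = mxA e *m P & x != 0 /\ P *m B = x *: (mxB *m P)].
Proof.
move=> uA uB A7 A1 BA B3.
have [z pz /eigenvalueP[v vA v0]] := eigenvalue_of_order7 A7 A1.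
have z7 := prim_expr_order pz.
(* Determinants in [BA] give (det A)^3 = 1, and [A7] gives (det A)^7 = 1. *)
have detA : \det A = 1.
  have detX i : \det (A ^+ i) = \det A ^+ i.
    elim: i => [|i IHi]; first by rewrite det1.
    by rewrite !exprS -mulmxE det_mulmx IHi.
  have d7 : \det A ^+ 7 = 1 by rewrite -detX A7 det1.
  have d0 : \det A != 0 by rewrite -unitfE -unitmxE.
  have := congr1 determinant BA; rewrite [LHS]det_mulmx [RHS]det_mulmx detX mulrC.
  have dB : \det B != 0 by rewrite -unitfE -unitmxE.
  move/(mulIf dB) => d4; have d3 : \det A ^+ 3 = 1.
    by apply: (mulIf d0); rewrite mul1r -exprSr.
  apply: etrans d7; transitivity ((\det A ^+ 3) ^+ 2 * \det A); last by ring.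
  by rewrite d3 expr1n mul1r.
have AB (w : 'rV[k]_4) x : w *m A = x *: w -> w *m B *m A = x ^+ 4 *: (w *m B).
  move=> wA; have wAi i : w *m A ^+ i = x ^+ i *: w.
    elim: i => [|i IHi]; first by rewrite mulmx1 scale1r.
    by rewrite exprSr -mulmxE mulmxA IHi -scalemxAl wA scalerA -exprSr.
  by rewrite -mulmxA BA mulmxA wAi scalemxAl.
have vBA := AB _ _ vA; have vBBA := AB _ _ vBA.
have z16 : (z ^+ 4) ^+ 4 = z ^+ 2 by ring: z7.
rewrite z16 in vBBA.
have wB0 (w : 'rV[k]_4) : w != 0 -> w *m B != 0.
  by apply: contra_neq => /(congr1 (mulmx^~ (invmx B))); rewrite mulmxK // mul0mx.
have vB0 := wB0 _ v0; have vBB0 := wB0 _ vB0.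
have /eigenvalueP[w wA w0] : eigenvalue A 1.
  by apply: (eigenvalue1 pz detA); apply/eigenvalueP;
    [exists v | exists (v *m B *m B) | exists (v *m B)].
rewrite scale1r in wA.
(* The vectors v, v B, v B B have eigenvalues z, z^4, z^2, which are e^4, e^2, e for e = z^2: the
   order of the diagonal of [mxA e]. *)
pose e := z ^+ 2.
have pe : 7.-primitive_root e by rewrite /e prim_root_exp_coprime.
(* The parameter absorbs the scale of [B]: with c its eigenvalue on w, so that B^3 = c^3, the value
   b = c^-1 yields P B = c (mxB P). *)
pose P b := rows4 v (b *: (v *m B)) (b ^+ 2 *: (v *m B *m B)) w.
have PA b : P b *m A = mxA e *m P b.
  rewrite rows4_mulmx mulmx_rows4 -!scalemxAl vA vBA vBBA wA.
  rewrite !(scale0r, addr0, add0r, scale1r) !scalerA.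
  by congr rows4; congr (_ *: _); rewrite /e; ring: z7.
pose d (i : 'I_4) := e ^+ (nth 0 [:: 4; 2; 1; 0] i)%N.
have uP b : b != 0 -> P b \in unitmx.
  move=> b0; apply: (@eigenrows_unit _ _ A (P b) d).
  - move=> i j /eqP; rewrite /d (eq_prim_root_expr pe).
    by case: i j => [[|[|[|[|//]]]] ?] [[|[|[|[|//]]]] ?] // _; apply: val_inj.
  - move=> i; rewrite -row_mul PA mulmx_rows4.
    by case: i => [[|[|[|[|//]]]] ?]; rewrite !rowK /d /=
      !(scale0r, addr0, add0r, scale1r, expr0, expr1).
  - case=> [[|[|[|[|//]]]] ?]; rewrite rowK //= scaler_eq0 ?expf_eq0 (negPf b0);
      by rewrite ?andbF ?orFb.
(* [AB] shows that w B is fixed by [A]. In the eigenbasis [P 1] its coordinates on the eigenvalues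
   e^4, e^2, e therefore vanish. *)
have [c wBc] : exists c, w *m B = c *: w.
  have uP1 := uP 1 (oner_neq0 _); pose x := w *m B *m invmx (P 1).
  have wBx : w *m B = x *m P 1 by rewrite mulmxKV.
  have xA : x *m mxA e = x.
    apply: (can_inj (mulmxK uP1)); rewrite -mulmxA -PA mulmxA -wBx.
    by rewrite (AB _ 1) ?scale1r // expr1n scale1r.
  have x0 (i : 'I_4) : (i < 3)%N -> x 0 i = 0.
    move=> i3; have := congr1 (fun M : 'rV_4 => M 0 i) xA.
    have -> : mxA e = diag_mx (\row_j d j).
      by apply/matrixP=> -[[|[|[|[|//]]]] ?] -[[|[|[|[|//]]]] ?]; rewrite !mxE.
    rewrite mul_mx_diag !mxE => /eqP; rewrite -[RHS in _ == RHS]mulr1 -subr_eq0.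
    rewrite -mulrBr mulf_eq0 subr_eq0 /d => /orP[/eqP // |].
    rewrite -(prim_order_dvd pe); by case: i i3 => [[|[|[|//]]] ?].
  exists (x 0 ord_max); rewrite wBx mulmx_sum_row big_ord_recr /= rowK /=.
  by rewrite big1 ?add0r // => i _; rewrite x0 ?scale0r //= ltn_ord.
have c0 : c != 0.
  by apply: contra_neq (wB0 _ w0) => c0; rewrite wBc c0 scale0r.
have yc : y = c ^+ 3.
  have : w *m (B *m (B *m B)) = c ^+ 3 *: w.
    by rewrite !mulmxA wBc -!scalemxAl wBc -scalemxAl wBc !scalerA; congr (_ *: _); ring.
  rewrite B3 mul_mx_scalar => /eqP; rewrite -subr_eq0 -scalerBl scaler_eq0 (negPf w0) orbF.
  by rewrite subr_eq0 => /eqP.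
exists (P c^-1), e, c; split=> //; first by apply: uP; rewrite invr_eq0.
split=> //; rewrite rows4_mulmx mulmx_rows4 wBc -!scalemxAl.
have -> : v *m B *m B *m B = c ^+ 3 *: v by rewrite -2!mulmxA B3 mul_mx_scalar yc.
rewrite !(scale0r, addr0, add0r, scale1r).
have rowsZ x r0 r1 r2 r3 :
    x *: rows4 r0 r1 r2 r3 = rows4 (x *: r0) (x *: r1) (x *: r2) (x *: r3).
  by apply/row_matrixP => -[[|[|[|[|//]]]] ?]; rewrite linearZ /= !rowK.
rewrite rowsZ !scalerA mulfV // scale1r.
by congr rows4; congr (_ *: _); field.
Qed.

Lemma AB_classification (A B : 'M[k]_4) x y z : A \in unitmx -> B \in unitmx ->
    A ^+ 7 = x%:M -> ~~ is_scalar_mx A -> B *m A = y *: (A ^+ 4 *m B) ->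
    B *m (B *m B) = z%:M ->
  exists P e a b, [/\ 7.-primitive_root e, P \in unitmx,
    a != 0 /\ P *m A = a *: (mxA e *m P) & b != 0 /\ P *m B = b *: (mxB *m P)].
Proof.
move=> uA uB A7 As BA B3.
have [r rx] : exists r, r ^+ 7 = x.
  have [r Er] := @solve_monicpoly k 7 (fun i => if i is 0%N then x else 0) isT.
  by exists r; rewrite Er !big_ord_recl big_ord0 /= !mul0r !addr0 mulr1.
have x0 : x != 0.
  have /negP : ~~ ((0 : 'M[k]_4) \in unitmx) by rewrite unitmxE det0 unitr0.
  apply: contra_not_neq => x0; rewrite -(scale0r 1%:M) scalemx1 -x0 -A7.
  by rewrite -[_ \in _]/(_ \is a GRing.unit) unitrX.
have r0 : r != 0 by apply: contra_neq x0 => r0; rewrite -rx r0 expr0n.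
have BAi i : B *m A ^+ i = y ^+ i *: (A ^+ (4 * i) *m B).
  elim: i => [|i IHi]; first by rewrite muln0 mulmx1 mul1mx scale1r.
  rewrite exprSr -mulmxE mulmxA IHi -scalemxAl -mulmxA BA -scalemxAr scalerA.
  by rewrite mulmxA mulmxE -exprD -exprSr mulnS addnC.
(* Moving [B] across the scalar A^7 = x gives y^7 x^3 = 1, with x = r^7. *)
have y7 : (y * r ^+ 3) ^+ 7 = 1.
  have x4 : (x%:M : 'M[k]_4) ^+ 4 = (x ^+ 4)%:M by rewrite -rmorphXn.
  have /eqP := BAi 7; rewrite mulnC exprM A7 x4 mul_mx_scalar mul_scalar_mx scalerA.
  rewrite -subr_eq0 -scalerBl scaler_eq0 => /orP[|/eqP B0].
    rewrite subr_eq0 => /eqP xE; apply: (mulIf x0); rewrite mul1r {2}xE -rx; ring.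
  by move: uB; rewrite B0 unitmxE det0 unitr0.
(* The rescaled matrix nu A needs nu^7 x = 1 and nu^3 = y. With zeta = y r^3 a seventh root of
   unity, nu = zeta^5 / r satisfies both, since 5 is the inverse of 3 modulo 7. *)
pose nu := (y * r ^+ 3) ^+ 5 / r.
have nu7 : nu ^+ 7 * x = 1.
  rewrite -rx /nu expr_div_n mulfVK ?expf_neq0 // -exprM mulnC exprM y7 expr1n.
  by [].
have nu3 : nu ^+ 3 = y.
  rewrite /nu expr_div_n -exprM; apply: (mulIf (expf_neq0 3 r0)).
  rewrite mulfVK ?expf_neq0 //.
  transitivity (((y * r ^+ 3) ^+ 7) ^+ 2 * (y * r ^+ 3)); first by ring.
  by rewrite y7 expr1n mul1r.
have nu0 : nu != 0 by apply: contra_eq_neq nu7 => ->; rewrite expr0n mul0r eq_sym oner_eq0.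
have [P [e [b [pe uP PA [b0 PB]]]]] : exists P e b, [/\ 7.-primitive_root e,
    P \in unitmx, P *m (nu *: A) = mxA e *m P & b != 0 /\ P *m B = b *: (mxB *m P)].
  apply: (@AB_classification_normalized (nu *: A) B z) => //.
  - by rewrite unitmxZ ?unitfE.
  - by rewrite exprZn A7 scale_scalar_mx nu7.
  - apply: contraNneq As => nuA; apply/is_scalar_mxP; exists nu^-1.
    by rewrite -scalemx1 -[1%:M]nuA scalerA mulVf // scale1r.
  by rewrite -scalemxAr BA scalerA exprZn -scalemxAl -nu3 -exprS.
exists P, e, nu^-1, b; split=> //; split; first by rewrite invr_eq0.
by rewrite -PA -scalemxAr scalerA mulVf // scale1r.
Qed.

End FirstGenerators.

(** * Representations *)

Local Notation a := (PSLclass gen_a).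
Local Notation b := (PSLclass gen_b).
Local Notation c := (PSLclass gen_c).

Section MorphismsFromPSL2F7.
Variable H : groupType.
Implicit Types f g : PSL2F7 -> H.

Lemma PSL2F7_morphism_ext f g :
    monoid.monoid_morphism f -> monoid.monoid_morphism g ->
    f a = g a -> f b = g b -> f c = g c -> f =1 g.
Proof.
move=> [_ fM] [_ gM] fa fb fc; apply: PSL2F7_gen_ind => // x y Ex Ey.
by rewrite fM gM Ex Ey.
Qed.

Lemma monoid_morphismV f x : monoid.monoid_morphism f -> f x^-1%g = (f x)^-1%g.
Proof. by case=> f1 fM; apply: (mulgI (f x)); rewrite mulgV -fM mulgV f1. Qed.

Lemma monoid_morphismX f x i : monoid.monoid_morphism f -> f (x ^+ i)%g = (f x ^+ i)%g.
Proof. by case=> f1 fM; elim: i => [|i IHi] //; rewrite !expgS fM IHi. Qed.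

Lemma PSL2F7_relations_morphism f : monoid.monoid_morphism f ->
  PSL2F7_relations (f a) (f b) (f c).
Proof.
move=> mf; have [f1 fM] := mf; have [a7 b3 c2 [ba cbc cac]] := PSLclass_relations.
have fX x i := monoid_morphismX x i mf.
split; last split.
- by rewrite -(fX a) -[RHS]f1; exact: (congr1 f a7).
- by rewrite -(fX b) -[RHS]f1; exact: (congr1 f b3).
- by rewrite -(fM c c) -[RHS]f1; exact: (congr1 f c2).
- by rewrite -(fM b a) -(fX a) -(fM (a ^+ 4)%g b); exact: (congr1 f ba).
- by rewrite -(fM c b) -(fM (c * b)%g c) -(fX b); exact: (congr1 f cbc).
rewrite -(fM c a) -(fM (c * a)%g c) -(fX a) -(fM (a ^+ 6)%g c).
by rewrite -(fM (a ^+ 6 * c)%g (a ^+ 6)%g); exact: (congr1 f cac).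
Qed.

(** The agreement of images is propagated from generators to products, without naming the
    automorphism that relates f to g. *)
Lemma PSL2F7_range_sub f g :
    monoid.monoid_morphism f -> monoid.monoid_morphism g ->
    f a = (g a)^-1%g -> f b = g b -> f c = g c ->
  (range f `<=` range g)%classic.
Proof.
move=> [_ fM] mg fa fb fc _ [x _ <-]; have [g1 gM] := mg.
elim/PSL2F7_gen_ind: x => [||| x y [x' _ Ex] [y' _ Ey]].
- by exists a^-1%g => //; rewrite monoid_morphismV.
- by exists b.
- by exists c.
by exists (x' * y')%g => //; rewrite gM Ex Ey fM.
Qed.

End MorphismsFromPSL2F7.

Section Equivalence.
Variables (n : nat) (k : fieldType).
Implicit Types rho : PSL2F7 -> PGL n k.

Lemma equivalentP rho1 rho2 : equivalent rho1 rho2 <->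
  exists g : PGL n k, forall x, rho2 x = (g * rho1 x * g^-1)%g.
Proof.
split=> [[sigma [g gE] rE] | [g gE]]; first by exists g => x; rewrite rE /= gE.
by exists (fun x => g * x * g^-1)%g => //; exists g.
Qed.

Lemma equivalent_refl rho : equivalent rho rho.
Proof. by apply/equivalentP; exists 1%g => x; rewrite mul1g invg1 mulg1. Qed.

Lemma equivalent_sym rho1 rho2 : equivalent rho1 rho2 -> equivalent rho2 rho1.
Proof.
case/equivalentP=> g gE; apply/equivalentP; exists g^-1%g => x.
by rewrite gE invgK !mulgA mulVg mul1g mulgKV.
Qed.

Lemma equivalent_trans rho1 rho2 rho3 :
  equivalent rho1 rho2 -> equivalent rho2 rho3 -> equivalent rho1 rho3.
Proof.
case/equivalentP=> g gE /equivalentP[h hE]; apply/equivalentP.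
by exists (h * g)%g => x; rewrite hE gE invMg !mulgA.
Qed.

Lemma conj_morphism rho g : monoid.monoid_morphism rho ->
  monoid.monoid_morphism (fun x => g * rho x * g^-1)%g.
Proof.
case=> rho1 rhoM; split; first by rewrite rho1 mulg1 mulgV.
by move=> x y; rewrite rhoM !mulgA mulgKV.
Qed.

Lemma equivalent_of_gens rho1 rho2 g :
    monoid.monoid_morphism rho1 -> monoid.monoid_morphism rho2 ->
    rho2 a = (g * rho1 a * g^-1)%g -> rho2 b = (g * rho1 b * g^-1)%g ->
    rho2 c = (g * rho1 c * g^-1)%g ->
  equivalent rho1 rho2.
Proof.
move=> m1 m2 Ea Eb Ec; apply/equivalentP; exists g.
exact: (PSL2F7_morphism_ext m2 (conj_morphism g m1) Ea Eb Ec).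
Qed.

Lemma mxclass_conj (P M N : 'M[k]_n) x : P \in unitmx -> M \in unitmx ->
    N \in unitmx -> x != 0 -> P *m M = x *: (N *m P) ->
  mxclass N = (mxclass P * mxclass M * (mxclass P)^-1)%g.
Proof.
move=> uP uM uN x0 PM; rewrite -mxclassM // PM mxclassZ ?unitmx_mul ?uN //.
by rewrite mxclassM // mulgK.
Qed.

Lemma kappa_morphism rho : monoid.monoid_morphism rho ->
  monoid.monoid_morphism (kappa \o rho).
Proof.
case=> rho1 rhoM; split; last by move=> x y; rewrite /= rhoM kappaM.
by rewrite /= rho1 -mxclass1 kappa_mxclass ?unitmx1 // trmx1 invmx1.
Qed.

Lemma kappa_mxclass_eq (M N : 'M[k]_n) x : M \in unitmx -> N \in unitmx ->
  x != 0 -> M^T *m N = x%:M -> kappa (mxclass M) = mxclass N.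
Proof.
move=> uM uN x0 MN; rewrite kappa_mxclass //; apply/mxclassP => //.
  by rewrite unitmx_inv unitmx_tr.
have uMT : M^T \in unitmx by rewrite unitmx_tr.
by exists x => //; rewrite -[LHS](mulKmx uMT) MN mul_mx_scalar.
Qed.

End Equivalence.

(** Existence of one representation ensures that [xget] returns one meeting the specification and
    not its default. *)
Lemma rep_with_the_rep (k : fieldType) (A B C : 'M[k]_4) :
    PSL2F7_relations (mxclass A) (mxclass B) (mxclass C) -> mxclass A != 1%g ->
  rep_with A B C (the_rep A B C).
Proof.
move=> rel A1; have [rho [mrho [Ea Eb Ec] inj]] := PSL2F7_presentation rel.
apply: (@xgetPex _ _ [set rho | rep_with A B C rho]%classic); exists rho.
by split=> //; split=> //; exact: inj A1.
Qed.

(** Instantiated at [C := mxC_sqrt2 s] with [D := 7] and at [C := mxC_0] with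
    [D := 1]. *)
Section Family.
Variable k : fieldType.
Hypothesis char_k : [pchar k] =i pred0.
Variables (eps D : k) (C : k -> 'M[k]_4).
Hypothesis prim_eps : 7.-primitive_root eps.
Hypothesis D0 : D != 0.
Hypothesis C_unit : forall e, 7.-primitive_root e -> C e \in unitmx.
Hypothesis C_rel : forall e, 7.-primitive_root e ->
  PSL2F7_relations (mxclass (mxA e)) (mxclass mxB) (mxclass (C e)).
Hypothesis C_tr : forall e, (C e)^T = C e.
Hypothesis C_sqr : forall e, 7.-primitive_root e -> C e *m C e = D%:M.
Hypothesis C_expr6 : forall e, 7.-primitive_root e -> C (e ^+ 6) = C e.
Hypothesis C_expr2 : forall e, 7.-primitive_root e ->
  mxB *m mxB *m C e = C (e ^+ 2) *m (mxB *m mxB).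

Definition family i : PSL2F7 -> PGL 4 k :=
  the_rep (mxA (eps ^+ i)) mxB (C (eps ^+ i)).

Let prim i : (1 <= i <= 6)%N -> 7.-primitive_root (eps ^+ i).
Proof.
case/andP=> i1 i6; rewrite prim_root_exp_coprime // coprime_sym prime_coprime //.
by rewrite gtnNdvd.
Qed.

Let eps7 : eps ^+ 7 = 1. Proof. exact: prim_expr_order. Qed.

Let uA (e : k) : 7.-primitive_root e -> mxA e \in unitmx.
Proof. by move=> pe; rewrite mxA_unit ?prim7_neq0. Qed.

Lemma family_rep i : (1 <= i <= 6)%N ->
  rep_with (mxA (eps ^+ i)) mxB (C (eps ^+ i)) (family i).
Proof.
by move/prim => pe; apply: rep_with_the_rep; [exact: C_rel | exact: mxclass_mxA_neq1].
Qed.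

Lemma family_double i j : (1 <= i <= 6)%N -> (1 <= j <= 6)%N ->
  j = 2 * i %[mod 7] -> equivalent (family i) (family j).
Proof.
move=> hi hj Eij; have pi := prim hi; have pj := prim hj.
have [[mi _] ia ib ic] := family_rep hi; have [[mj _] ja jb jc] := family_rep hj.
have Ej : eps ^+ j = (eps ^+ i) ^+ 2.
  by apply/eqP; rewrite -exprM mulnC (eq_prim_root_expr prim_eps) Eij.
have uB2 : mxB *m mxB \in (unitmx : pred 'M[k]_4) by rewrite unitmx_mul !mxB_unit.
apply: (equivalent_of_gens (g := mxclass (mxB *m mxB)) mi mj).
- rewrite ia ja Ej; apply: (mxclass_conj (x := 1)); rewrite -?Ej ?uA ?oner_eq0 //.
  rewrite Ej scale1r mxB_sqr !mulmx4; have e7 := prim_expr_order pi.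
  by apply/mx4_eq; do 2?split; ring: e7.
- rewrite ib jb; apply: (mxclass_conj (x := 1)); rewrite ?mxB_unit ?oner_eq0 //.
  by rewrite scale1r mulmxA.
rewrite ic jc Ej; apply: (mxclass_conj (x := 1)); rewrite -?Ej ?C_unit ?oner_eq0 //.
by rewrite Ej scale1r C_expr2.
Qed.

Lemma family_I1 i j : i \in I1 -> j \in I1 -> equivalent (family i) (family j).
Proof.
have E12 : equivalent (family 1) (family 2) by apply: family_double.
have E24 : equivalent (family 2) (family 4) by apply: family_double.
have E1 l : l \in I1 -> equivalent (family 1) (family l).
  rewrite !inE => /or3P[] /eqP->; [exact: equivalent_refl | exact: E12 |].
  exact: equivalent_trans E12 E24.
by move=> /E1 Ei /E1; apply: equivalent_trans (equivalent_sym Ei).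
Qed.

Lemma family_I2 i j : i \in I2 -> j \in I2 -> equivalent (family i) (family j).
Proof.
have E36 : equivalent (family 3) (family 6) by apply: family_double.
have E65 : equivalent (family 6) (family 5) by apply: family_double.
have E6 l : l \in I2 -> equivalent (family 6) (family l).
  rewrite !inE => /or3P[] /eqP->; [exact: equivalent_sym | exact: E65 |].
  exact: equivalent_refl.
by move=> /E6 Ei /E6; apply: equivalent_trans (equivalent_sym Ei).
Qed.

Let p1 : (1 <= 1 <= 6)%N. Proof. by []. Qed.
Let p6 : (1 <= 6 <= 6)%N. Proof. by []. Qed.

Let mxA_inv : mxA eps *m mxA (eps ^+ 6) = 1%:M.
Proof. by rewrite mxAM -exprS eps7 mxA1. Qed.

(** The contragredient inverts the diagonal matrix [A], fixes the permutation matrix [B], and fixes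
    the class of [C], which is symmetric with scalar square and invariant under inversion of
    [eps]. *)
Lemma family_kappa : family 6 =1 kappa \o family 1.
Proof.
have [[m1 _] a1 b1 c1] := family_rep p1; have [[m6 _] a6 b6 c6] := family_rep p6.
have pe6 := prim p6.
rewrite expr1 in a1 c1.
apply: (PSL2F7_morphism_ext m6 (kappa_morphism m1)).
- apply: etrans a6 (etrans _ (esym (congr1 kappa a1))).
  apply/esym/(kappa_mxclass_eq (x := 1)); rewrite ?uA ?oner_eq0 //.
  suff -> : (mxA eps)^T = mxA eps by exact: mxA_inv.
  by apply/matrixP=> -[[|[|[|[|//]]]] ?] -[[|[|[|[|//]]]] ?]; rewrite !mxE.
- apply: etrans b6 (etrans _ (esym (congr1 kappa b1))).
  apply/esym/(kappa_mxclass_eq (x := 1)); rewrite ?mxB_unit ?oner_eq0 //.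
  have -> : mxB^T = mxB *m mxB :> 'M[k]_4.
    rewrite mxB_sqr.
    by apply/matrixP=> -[[|[|[|[|//]]]] ?] -[[|[|[|[|//]]]] ?]; rewrite !mxE.
  by rewrite -mulmxA mxB_cube.
apply: etrans c6 (etrans _ (esym (congr1 kappa c1))).
apply/esym/(kappa_mxclass_eq (x := D)); rewrite ?C_unit //.
by rewrite C_tr C_expr6 // C_sqr.
Qed.

Lemma family_range : range (family 1) = range (family 6).
Proof.
have [[m1 _] a1 b1 c1] := family_rep p1; have [[m6 _] a6 b6 c6] := family_rep p6.
rewrite expr1 in a1 c1.
have inv : (mxclass (mxA eps) * mxclass (mxA (eps ^+ 6)) = 1)%g.
  by rewrite -mxclassM ?uA ?prim // mxA_inv mxclass1.
have a16 : family 1 a = (family 6 a)^-1%g.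
  apply: etrans a1 (etrans _ (esym (congr1 invg a6))).
  by apply: (mulIg (mxclass (mxA (eps ^+ 6)))); rewrite mulVg.
have b16 : family 1 b = family 6 b := etrans b1 (esym b6).
have c16 : family 1 c = family 6 c by apply: etrans c1 (etrans _ (esym c6)); rewrite C_expr6.
have a61 := esym (etrans (congr1 invg a16) (invgK _)).
apply/seteqP; split.
  exact: (PSL2F7_range_sub m1 m6 a16 b16 c16).
exact: (PSL2F7_range_sub m6 m1 a61 (esym b16) (esym c16)).
Qed.

(** Conjugacy in [PGL] allows a scalar x between the lifts. Since squaring permutes the exponents 1,
    2, 4, the traces of A and A^2 agree, giving T = x T' = x^2 T' and x = 1. But T and T' have sum 1
    and product 2, so T = T' would make the discriminant -7 vanish. *)
Lemma family_neq : ~ equivalent (family 1) (family 6).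
Proof.
have [_ a1 _ _] := family_rep p1; have [_ a6 _ _] := family_rep p6.
have pe6 := prim p6; have ue6 := uA pe6; have ue := uA prim_eps.
have e6 := prim7_expr6 prim_eps.
case/equivalentP=> g /(_ a); rewrite a1 a6 expr1.
have [P uP ->] := mxclass_surj g => Eg.
have : mxclass (mxA (eps ^+ 6) *m P) = mxclass (P *m mxA eps).
  by rewrite !mxclassM // Eg mulgKV.
case/mxclassP; rewrite ?unitmx_mul ?uP ?ue ?ue6 // => x x0 PA.
pose tr e : k := 1 + e + e ^+ 2 + e ^+ 4.
have trA (e : k) : \tr (mxA e) = tr e.
  by rewrite /mxtrace !big_ord_recl big_ord0 !mxE /= /tr; ring.
have conjE M N y : P *m M = y *: (N *m P) -> \tr M = y * \tr N.
  move=> PM; rewrite -[in LHS](mulKmx uP M) PM -scalemxAr mxtraceZ mxtrace_mulC.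
  by rewrite mulmxK.
have E1 : tr eps = x * tr (eps ^+ 6) by rewrite -!trA; apply: conjE.
have E2 : tr (eps * eps) = x ^+ 2 * tr (eps ^+ 6 * eps ^+ 6).
  rewrite -!trA; apply: conjE.
  rewrite -(mxAM eps eps) -(mxAM (eps ^+ 6) (eps ^+ 6)) mulmxA PA -scalemxAl -mulmxA PA.
  by rewrite -scalemxAr scalerA mulmxA.
have T2 : tr eps * tr (eps ^+ 6) = 2 by rewrite /tr; ring: e6.
have T1 : tr eps + tr (eps ^+ 6) = 1 by rewrite /tr; ring: e6.
have Esq : tr (eps * eps) = tr eps by rewrite /tr; ring: e6.
have Esq6 : tr (eps ^+ 6 * eps ^+ 6) = tr (eps ^+ 6) by rewrite /tr; ring: e6.
have natr_neq0 m : m.+1%:R != 0 :> k by rewrite ((pcharf0P k).1 char_k).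
have T60 : tr (eps ^+ 6) != 0.
  by apply: contra_eq_neq T2 => ->; rewrite mulr0 eq_sym.
have x1 : x = 1.
  apply: (mulfI x0); apply: (mulIf T60).
  by rewrite mulr1 -expr2 -E1 -Esq6 -E2 Esq.
rewrite x1 mul1r in E1; rewrite -E1 in T1 T2.
have : 7 = 0 :> k.
  transitivity (4 * (tr eps * tr eps) - (tr eps + tr eps) ^+ 2); last by ring.
  by rewrite T1 T2; ring.
by apply/eqP.
Qed.

End Family.

Lemma relations_mxclassP (k : fieldType) (A B C : 'M[k]_4) :
    A \in unitmx -> B \in unitmx -> C \in unitmx ->
    PSL2F7_relations (mxclass A) (mxclass B) (mxclass C) ->
  [/\ exists x, A ^+ 7 = x%:M, exists x, B *m (B *m B) = x%:M,
      exists x, C *m C = x%:M & [/\ exists x, B *m A = x *: (A ^+ 4 *m B),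
      exists x, B *m C *m B = x *: C
    & exists x, C *m A *m C = x *: (A ^+ 6 *m C *m A ^+ 6)]].
Proof.
move=> uA uB uC [A7 B3 C2 [BA CBC CAC]].
have uX i : A ^+ i \in unitmx by rewrite -[_ \in _]/(_ \is a GRing.unit) unitrX.
have lift M N : M \in unitmx -> N \in unitmx -> mxclass M = mxclass N ->
    exists x : k, N = x *: (M : 'M[k]_4).
  by move=> uM uN /(mxclassP uM uN)[x _ ->]; exists x.
have lift1 M : M \in unitmx -> mxclass M = 1%g -> exists x : k, (M : 'M[k]_4) = x%:M.
  move=> uM; rewrite -mxclass1 => /esym/(lift _ _ (unitmx1 _ _) uM)[x ->].
  by exists x; rewrite scalemx1.
(* Equivalent to cbc = b^2, but linear in [C]. *)
have BCB : (mxclass B * mxclass C * mxclass B = mxclass C)%g.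
  have B3' : (mxclass B * mxclass B ^+ 2 = 1)%g by rewrite -expgS.
  apply: (mulIg (mxclass C)); rewrite C2 -!mulgA (mulgA (mxclass C)) CBC.
  exact: B3'.
split; [| | |split].
- by apply: lift1; rewrite ?uX // mxclassX.
- by apply: lift1; rewrite ?unitmx_mul ?uB // !mxclassM ?unitmx_mul ?uB.
- by apply: lift1; rewrite ?unitmx_mul ?uC // mxclassM.
- apply: lift; rewrite ?unitmx_mul ?uA ?uB ?uX //.
  by rewrite (mxclassM uB uA) (mxclassM (uX 4) uB) mxclassX.
- by apply: lift; rewrite ?unitmx_mul ?uB ?uC // !mxclassM ?unitmx_mul ?uB.
have uCA : C *m A \in unitmx by rewrite unitmx_mul uC.
have uAC : A ^+ 6 *m C \in unitmx by rewrite unitmx_mul uX.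
apply: lift; rewrite ?unitmx_mul ?uA ?uC ?uX //.
by rewrite (mxclassM uCA uC) (mxclassM uC uA) (mxclassM uAC (uX 6))
  (mxclassM (uX 6) uC) mxclassX.
Qed.

Lemma PSLclass_gen_a_neq1 : a != 1%g.
Proof.
apply/negP => /eqP; rewrite -PSLclass1.
have [da _ _] := det_gens; case/(PSLclass_eq da (det1 _ _)).
  by move/(congr1 (fun M : 'M['F_7]_2 => M 0 1)); rewrite !mxE.
by move/(congr1 (fun M : 'M['F_7]_2 => M 0 1)); rewrite !mxE.
Qed.

Section PaperRepresentations.
Variable k : fieldType.
Hypothesis char_k : [pchar k] =i pred0.
Variable s : k.
Hypothesis s2 : s ^+ 2 = 2.
Implicit Types e t x y z : k.

Lemma mxZ_tr t x y z : (mxZ t x y z)^T = mxZ t x y z.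
Proof.
by apply/matrixP=> -[[|[|[|[|//]]]] ?] -[[|[|[|[|//]]]] ?]; rewrite !mxE.
Qed.

Lemma mxB_sqr_mxZ t x y z :
  mxB *m mxB *m mxZ t x y z = mxZ t y z x *m (mxB *m mxB).
Proof. by rewrite mxB_sqr !mulmx4; apply/mx4_eq; do 2?split; ring. Qed.

Lemma mxC_sqrt2_sqr e : 7.-primitive_root e ->
  mxC_sqrt2 s e *m mxC_sqrt2 s e = 7%:M.
Proof.
move=> /prim7_expr6 e6; apply/(mxG_sqrP s s _ _ _ 1 7).
by split; ring: e6 s2.
Qed.

Lemma mxC_sqrt2_expr6 e : 7.-primitive_root e ->
  mxC_sqrt2 s (e ^+ 6) = mxC_sqrt2 s e.
Proof.
by move=> /prim_expr_order e7; congr mxZ; ring: e7.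
Qed.

Lemma mxC_sqrt2_expr2 e : 7.-primitive_root e ->
  mxB *m mxB *m mxC_sqrt2 s e = mxC_sqrt2 s (e ^+ 2) *m (mxB *m mxB).
Proof.
move=> /prim_expr_order e7; rewrite mxB_sqr_mxZ; congr (mxZ _ _ _ _ *m _); ring: e7.
Qed.

Lemma mxC_0_sqr e : 7.-primitive_root e -> mxC_0 e *m mxC_0 e = 1%:M.
Proof.
move=> /prim7_expr6 e6; apply/(mxG_sqrP 0 0 _ _ _ 1 1).
have natr_neq0 n : n.+1%:R != 0 :> k by rewrite ((pcharf0P k).1 char_k).
by split; field: e6.
Qed.

Lemma mxC_0_expr6 e : 7.-primitive_root e -> mxC_0 (e ^+ 6) = mxC_0 e.
Proof. by move=> /prim_expr_order e7; congr mxZ; ring: e7. Qed.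

Lemma mxC_0_expr2 e : 7.-primitive_root e ->
  mxB *m mxB *m mxC_0 e = mxC_0 (e ^+ 2) *m (mxB *m mxB).
Proof.
move=> /prim_expr_order e7; rewrite mxB_sqr_mxZ; congr (mxZ _ _ _ _ *m _); ring: e7.
Qed.

End PaperRepresentations.

Section FaithfulRepresentations.
Variable k : closedFieldType.
Hypothesis char_k : [pchar k] =i pred0.
Variables eps s : k.
Hypothesis prim_eps : 7.-primitive_root eps.
Hypothesis s2 : s ^+ 2 = 2.

Lemma faithful_rep_classification (rho : PSL2F7 -> PGL 4 k) : faithful_rep rho ->
  exists2 i, (1 <= i <= 6)%N &
    equivalent rho (phi_0 eps i) \/ equivalent rho (phi_sqrt2 s eps i).
Proof.
case=> mrho inj.
have [A uA EA] := mxclass_surj (rho a); have [B uB EB] := mxclass_surj (rho b).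
have [C uC EC] := mxclass_surj (rho c).
have rel : PSL2F7_relations (mxclass A) (mxclass B) (mxclass C).
  by rewrite -EA -EB -EC; exact: PSL2F7_relations_morphism.
have := relations_mxclassP uA uB uC rel; case=> [[x A7] [z B3] _ [[y BA] _ _]].
have As : ~~ is_scalar_mx A.
  apply/negP => /is_scalar_mxP[d Ad].
  have d0 : d != 0.
    by apply: contraTneq uA => d0; rewrite Ad d0 -scalemx1 scale0r unitmxE det0 unitr0.
  have : rho a = rho 1%g.
    by rewrite EA Ad -scalemx1 mxclassZ ?unitmx1 // mxclass1 mrho.1.
  by move/inj/eqP; rewrite (negPf PSLclass_gen_a_neq1).
have [P [e [da [db [pe uP [da0 PA] [db0 PB]]]]]] :=
  AB_classification prim_eps uA uB A7 As BA B3.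
have ue := mxA_unit (prim7_neq0 pe).
pose g := mxclass P; have mg := conj_morphism g mrho.
have Eg1 := mxclass_conj uP uA ue da0 PA; rewrite -EA in Eg1.
have Eg2 := mxclass_conj uP uB (mxB_unit k) db0 PB; rewrite -EB in Eg2.
have [C1 uC1 EC1] := mxclass_surj (g * rho c * g^-1)%g.
have rel1 : PSL2F7_relations (mxclass (mxA e)) (mxclass mxB) (mxclass C1).
  rewrite [X in PSL2F7_relations X]Eg1 [X in PSL2F7_relations _ X]Eg2 -EC1.
  exact: (PSL2F7_relations_morphism mg).
have := relations_mxclassP ue (mxB_unit k) uC1 rel1; case=> [_ _ [D CC] [_ [l BCB] [m CAC]]].
have AX i : mxA e ^+ i = mxA (e ^+ i).
  elim: i => [|i IHi]; first by rewrite !expr0 mxA1.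
  by rewrite !exprS IHi -mulmxE mxAM.
rewrite AX in CAC.
(* [Q] commutes with [mxA e] and [mxB], so this second change of basis keeps (a) and (b) in normal
   form while it normalizes (c). *)
have [Q [uQ QA QB [w w0 QC]]] := mxC_classification char_k pe s2 uC1 BCB CC CAC.
pose h := mxclass Q.
have conjM X Y Z : X = (h * Y * h^-1)%g -> Y = (g * Z * g^-1)%g ->
    X = (h * g * Z * (h * g)^-1)%g.
  by move=> -> ->; rewrite invMg !mulgA.
have comm M : M \in unitmx -> Q *m M = M *m Q -> mxclass M = (h * mxclass M * h^-1)%g.
  by move=> uM QM; apply: (mxclass_conj (x := 1)); rewrite ?oner_neq0 ?scale1r.
have equiv C2 rho2 : C2 \in unitmx -> rep_with (mxA e) mxB C2 rho2 ->
    Q *m C1 = w *: (C2 *m Q) -> equivalent rho rho2.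
  move=> uC2 [[m2 _] a2 b2 c2] QC2.
  apply: (equivalent_of_gens (g := (h * g)%g) mrho m2).
  - exact: etrans a2 (conjM _ _ _ (comm _ ue QA) Eg1).
  - exact: etrans b2 (conjM _ _ _ (comm _ (mxB_unit k) QB) Eg2).
  exact: etrans c2 (conjM _ _ _ (mxclass_conj uQ uC1 uC2 w0 QC2) (esym EC1)).
(* The root e comes from the spectrum of [A], so it is only some power of [eps]; exponent 0 would
   make the image of (a) trivial. *)
have [i Ei] := prim_rootP prim_eps (prim_expr_order pe).
have A1 := mxclass_mxA_neq1 pe.
exists (i : nat).
  apply/andP; split; last by rewrite -ltnS ltn_ord.
  rewrite lt0n; apply: contraNneq A1 => i0.
  by rewrite Ei i0 expr0 mxA1 mxclass1.
rewrite /phi_0 /phi_sqrt2 -Ei; case: QC => QC; [left | right]; apply: equiv QC.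
- exact: mxC_0_unit.
- by apply: rep_with_the_rep => //; exact: relations_0.
- exact: mxC_sqrt2_unit.
by apply: rep_with_the_rep => //; exact: relations_sqrt2.
Qed.

End FaithfulRepresentations.

Theorem proposition4p5 (k : closedFieldType) (char_k : [pchar k] =i pred0)
    (eps sqrt2 : k) (order_eps : 7.-primitive_root eps)
    (sqrt2_sqr : sqrt2 ^+ 2 = 2) :
  let phis : nat -> PSL2F7 -> PGL 4 k := phi_sqrt2 sqrt2 eps in
  let phi0 : nat -> PSL2F7 -> PGL 4 k := phi_0 eps in
  (* the representations exist, as presupposed by their definition *)
  (forall i : nat, (1 <= i <= 6)%N ->
     rep_with (mxA (eps ^+ i)) mxB (mxC_sqrt2 sqrt2 (eps ^+ i)) (phis i) /\
     rep_with (mxA (eps ^+ i)) mxB (mxC_0 (eps ^+ i)) (phi0 i)) /\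
  (* (1) *)
  [/\ forall i j : nat, i \in I1 -> j \in I1 -> equivalent (phis i) (phis j),
      forall i j : nat, i \in I2 -> j \in I2 -> equivalent (phis i) (phis j),
      ~ equivalent (phis 1%N) (phis 6%N),
      phis 6%N =1 kappa \o phis 1%N
    & range (phis 1%N) = range (phis 6%N)] /\
  (* (2) *)
  [/\ forall i j : nat, i \in I1 -> j \in I1 -> equivalent (phi0 i) (phi0 j),
      forall i j : nat, i \in I2 -> j \in I2 -> equivalent (phi0 i) (phi0 j),
      ~ equivalent (phi0 1%N) (phi0 6%N),
      phi0 6%N =1 kappa \o phi0 1%N
    & range (phi0 1%N) = range (phi0 6%N)] /\
  (* (3) *)
  (forall rho : PSL2F7 -> PGL 4 k, faithful_rep rho ->
     [\/ equivalent rho (phis 1%N), equivalent rho (phis 6%N),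
         equivalent rho (phi0 1%N) | equivalent rho (phi0 6%N)]) /\
  (* (4) *)
  (forall H : set (PGL 4 k), is_subgroup H -> isomorphic_to PSL2F7 H ->
     PGL_conjugate H (range (phis 1%N)) \/ PGL_conjugate H (range (phi0 1%N))).
Proof.
move=> phis phi0.
have n7 : 7 != 0 :> k by rewrite ((pcharf0P k).1 char_k).
pose C2 := mxC_sqrt2 sqrt2; pose C0 : k -> 'M[k]_4 := @mxC_0 k.
have u2 e pe : C2 e \in unitmx := mxC_sqrt2_unit char_k pe sqrt2_sqr.
have u0 e pe : C0 e \in unitmx := mxC_0_unit char_k pe.
have r2 e pe := @relations_sqrt2 k char_k e pe sqrt2 sqrt2_sqr.
have r0 e pe := @relations_0 k char_k e pe.
have t2 e : (C2 e)^T = C2 e by apply: mxZ_tr.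
have t0 e : (C0 e)^T = C0 e by apply: mxZ_tr.
have sqr2 := mxC_sqrt2_sqr sqrt2_sqr; have sqr0 := mxC_0_sqr char_k.
have x62 := @mxC_sqrt2_expr6 k sqrt2; have x60 := @mxC_0_expr6 k.
have x22 := @mxC_sqrt2_expr2 k sqrt2; have x20 := @mxC_0_expr2 k.
have I12 : forall i j, i \in I1 -> j \in I1 -> equivalent (phis i) (phis j).
  exact: (family_I1 order_eps u2 r2 x22).
have I10 : forall i j, i \in I1 -> j \in I1 -> equivalent (phi0 i) (phi0 j).
  exact: (family_I1 order_eps u0 r0 x20).
have I22 : forall i j, i \in I2 -> j \in I2 -> equivalent (phis i) (phis j).
  exact: (family_I2 order_eps u2 r2 x22).
have I20 : forall i j, i \in I2 -> j \in I2 -> equivalent (phi0 i) (phi0 j).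
  exact: (family_I2 order_eps u0 r0 x20).
have range2 : range (phis 1%N) = range (phis 6%N).
  exact: (family_range order_eps r2 x62).
have range0 : range (phi0 1%N) = range (phi0 6%N).
  exact: (family_range order_eps r0 x60).
have classify (rho : PSL2F7 -> PGL 4 k) : faithful_rep rho ->
    [\/ equivalent rho (phis 1%N), equivalent rho (phis 6%N),
        equivalent rho (phi0 1%N) | equivalent rho (phi0 6%N)].
  move=> frho; have [i hi E] := faithful_rep_classification char_k order_eps sqrt2_sqr frho.
  have : (i \in I1) || (i \in I2) by move: hi; case: i {E} => [|[|[|[|[|[|[|]]]]]]].
  by case/orP=> iI; case: E => E;
    [ apply: Or43; apply: equivalent_trans E (I10 _ _ iI _)
    | apply: Or41; apply: equivalent_trans E (I12 _ _ iI _)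
    | apply: Or44; apply: equivalent_trans E (I20 _ _ iI _)
    | apply: Or42; apply: equivalent_trans E (I22 _ _ iI _)].
split.
  move=> i hi; split; first exact: (family_rep order_eps r2 hi).
  exact: (family_rep order_eps r0 hi).
split; first split=> //.
- exact: (family_neq char_k order_eps r2).
- exact: (family_kappa order_eps n7 u2 r2 t2 sqr2 x62).
split; first split=> //.
- exact: (family_neq char_k order_eps r0).
- exact: (family_kappa order_eps (oner_neq0 k) u0 r0 t0 sqr0 x60).
split=> // H _ [f [mf injf <-]].
have range_conj rho : equivalent f rho -> PGL_conjugate (range f) (range rho).
  case/equivalentP=> g gE; exists g; apply/seteqP; split=> [_ [x _ <-]|].
    by exists (f x); rewrite -?gE //; exists x.
  by move=> _ [_ [x _ <-] <-]; exists x => //; rewrite gE.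
(* Four equivalence classes give two conjugacy classes of images, because indices 1 and 6 have the
   same image. *)
case: (classify f (conj mf injf)) => /range_conj; rewrite -?range2 -?range0; by [left | right].
Qed.
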